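(* Let $N\ge3$, $1\le k\le N/2$, $\eta\in\{-1,1\}$, and let $r,s$ be coprime integers with $s\ge1$. Let $(k,s)$ be the gcd of $k$ and $s$ and $s=(k,s)s'$. Then $G_{r/s}(N,k,\eta)$ is a semi-direct product of an Abelian group $H$ of order $2Ns$ by $\mathbb{Z}/2\mathbb{Z}$ (namely $H\rtimes\mathbb{Z}/2\mathbb{Z}$). The group $H$ is an extension by $\mathbb{Z}/2\mathbb{Z}$ of a group $K$ (i.e. there is an exact sequence $0\to K\to H\to\mathbb{Z}/2\mathbb{Z}\to0$), which is itself an extension of $\mathbb{Z}/Ns'\mathbb{Z}$ by $\mathbb{Z}/(k,s)\mathbb{Z}$ (i.e. there is an exact sequence $0\to\mathbb{Z}/Ns'\mathbb{Z}\to K\to\mathbb{Z}/(k,s)\mathbb{Z}\to0$).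
   Context: $\mathbb{R}^3=\mathbb{C}\times\mathbb{R}$, $\zeta=e^{2\pi i/N}$, bodies are labelled by $j\in\mathbb{Z}/N\mathbb{Z}$. Let $\omega_k=\left(\sum_{j=1}^{N-1}\frac{1-\zeta^{jk}}{|\zeta^j-1|^3}\right)^{1/2}>0$ (a frequency of the vertical variational equation along the regular $N$-gon relative equilibrium of $N$ unit masses) and $T=2\pi s/\omega_k$. Consider the $T$-periodic motion $S_{r/s}(N,k,\eta)$: $$x_j(t)=\left(\zeta^je^{i\frac rs\omega_kt},\ \mathrm{Re}(\zeta^{\eta kj}e^{i\omega_kt})\right),\quad j\in\mathbb{Z}/N\mathbb{Z}.$$ The group $G_0=O(\mathbb{R}/T\mathbb{Z})\times\Sigma(N)\times O(\mathbb{R}^3)$, where $O(\mathbb{R}/T\mathbb{Z})$ is the group of isometries of the circle $\mathbb{R}/T\mathbb{Z}$ and $\Sigma(N)$ is the group of permutations of the bodies, acts on $T$-periodic loops of $N$-body configurations: $g=(\tau,\sigma,\rho)$ acts by $(gx)_j(t)=\rho\,x_{\sigma^{-1}(j)}(\tau^{-1}(t))$. $G_{r/s}(N,k,\eta)$ is the stabilizer of $S_{r/s}(N,k,\eta)$ in $G_0$.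
   Formalization: Two families are excluded, since there the stabilizer has order at least 8N rather than the claimed 4Ns = 4N: k = 1, s = 1, r = η (all bodies move on one ellipse in a fixed plane), and 2k = N, r = 0 (a fixed N-gon with alternating vertical oscillations). *)

(* Defs.v *)
From HB Require Import structures.
From mathcomp Require Import all_boot all_order all_algebra all_fingroup.
From mathcomp Require Import all_solvable.
From mathcomp Require Import generic_quotient ring_quotient complex.
From mathcomp Require Import all_classical all_reals all_analysis.

Set Implicit Arguments.
Unset Strict Implicit.
Unset Printing Implicit Defensive.

Import Order.TTheory GRing.Theory Num.Theory.

Local Open Scope classical_set_scope.
Local Open Scope ring_scope.
Local Open Scope complex_scope.
Local Open Scope quotient_scope.

Section Circle.
Variables (R : realType) (T : R).

Definition periods : {pred R} :=
  fun x => `[< exists n : int, x = n%:~R * T >].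

Fact periods_zmod_closed : zmod_closed periods.
Proof.
split=> [|x y]; rewrite /periods !unfold_in.
  by apply/asboolP; exists (0 : int); rewrite mul0r.
move=> /asboolP[m ->] /asboolP[n ->]; apply/asboolP; exists (m - n).
by rewrite intrB mulrBl.
Qed.

HB.instance Definition _ :=
  GRing.isZmodClosed.Build R periods periods_zmod_closed.

Definition circle : Type := Quotient.quot periods.
HB.instance Definition _ := EqQuotient.on circle.
HB.instance Definition _ := GRing.Zmodule.on circle.

Definition circle_dist (x y : circle) : R :=
  inf [set d | exists a b : R,
         [/\ \pi_circle a = x, \pi_circle b = y & d = `|a - b| ] ].

(* The inverse is a field only to make the group operations explicit; it is
   determined by the underlying function (see circle_isom_eq).               *)
Record circle_isom := CircleIsom {
  isom_fun :> circle -> circle;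
  isom_inv : circle -> circle;
  isom_funK : cancel isom_fun isom_inv;
  isom_invK : cancel isom_inv isom_fun;
  isom_dist : forall x y,
    circle_dist (isom_fun x) (isom_fun y) = circle_dist x y }.

Lemma circle_isom_eq (f g : circle_isom) : isom_fun f =1 isom_fun g -> f = g.
Proof.
case: f g => [f f' fK f'K fd] [g g' gK g'K gd] /= /funext efg.
have efg' : f' = g' by apply/funext => x; rewrite -{1}(g'K x) -efg fK.
by subst; congr CircleIsom; apply: Prop_irrelevance.
Qed.

HB.instance Definition _ := gen_eqMixin circle_isom.
HB.instance Definition _ := gen_choiceMixin circle_isom.

Definition isom_one : circle_isom :=
  @CircleIsom id id (fun=> erefl) (fun=> erefl) (fun _ _ => erefl).

Fact isom_inv_dist (f : circle_isom) x y :
  circle_dist (isom_inv f x) (isom_inv f y) = circle_dist x y.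
Proof. by rewrite -(isom_dist f) !isom_invK. Qed.
Definition isom_opp (f : circle_isom) : circle_isom :=
  CircleIsom (isom_invK f) (isom_funK f) (isom_inv_dist f).

Fact isom_mul_dist (f g : circle_isom) x y :
  circle_dist ((f \o g) x) ((f \o g) y) = circle_dist x y.
Proof. by rewrite /= !isom_dist. Qed.
Definition isom_mul (f g : circle_isom) : circle_isom :=
  CircleIsom (can_comp (isom_funK f) (isom_funK g))
    (can_comp (isom_invK g) (isom_invK f)) (isom_mul_dist f g).

Fact isom_mulA : associative isom_mul.
Proof. by move=> f g h; apply: circle_isom_eq. Qed.
Fact isom_mul1 : left_id isom_one isom_mul.
Proof. by move=> f; apply: circle_isom_eq. Qed.
Fact isom_mulr1 : right_id isom_one isom_mul.
Proof. by move=> f; apply: circle_isom_eq. Qed.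
Fact isom_mulV : left_inverse isom_one isom_opp isom_mul.
Proof. by move=> f; apply: circle_isom_eq => x /=; rewrite isom_funK. Qed.
Fact isom_mulrV : right_inverse isom_one isom_opp isom_mul.
Proof. by move=> f; apply: circle_isom_eq => x /=; rewrite isom_invK. Qed.

HB.instance Definition _ := isGroup.Build circle_isom
  isom_mulA isom_mul1 isom_mulr1 isom_mulV isom_mulrV.

End Circle.

(* Permutations of the bodies, composed as functions from right to left: the
   library product of 'S_N is the opposite one, (s * t) j = t (s j).         *)
Definition body_perm (N : nat) : Type := 'S_N.
HB.instance Definition _ N := Choice.on (body_perm N).

Section BodyPerm.
Variable N : nat.

Definition bperm_mul (s t : body_perm N) : body_perm N :=
  ((t : 'S_N) * (s : 'S_N))%g.
Definition bperm_one : body_perm N := (1 : 'S_N)%g.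
Definition bperm_inv (s : body_perm N) : body_perm N := ((s : 'S_N)^-1)%g.

Fact bperm_mulA : associative bperm_mul.
Proof. by move=> s t u; rewrite /bperm_mul mulgA. Qed.
Fact bperm_mul1 : left_id bperm_one bperm_mul.
Proof. by move=> s; rewrite /bperm_mul mulg1. Qed.
Fact bperm_mulr1 : right_id bperm_one bperm_mul.
Proof. by move=> s; rewrite /bperm_mul mul1g. Qed.
Fact bperm_mulV : left_inverse bperm_one bperm_inv bperm_mul.
Proof. by move=> s; rewrite /bperm_mul mulgV. Qed.
Fact bperm_mulrV : right_inverse bperm_one bperm_inv bperm_mul.
Proof. by move=> s; rewrite /bperm_mul mulVg. Qed.

HB.instance Definition _ := isGroup.Build (body_perm N)
  bperm_mulA bperm_mul1 bperm_mulr1 bperm_mulV bperm_mulrV.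

End BodyPerm.

Section Orthogonal.
Variables (R : realType) (n : nat).

Definition orthogonal : Type := {A : 'M[R]_n | A *m A^T == 1%:M}.
HB.instance Definition _ := Choice.on orthogonal.
HB.instance Definition _ := SubType.on orthogonal.

Fact orth_one_subproof : (1%:M : 'M[R]_n) *m 1%:M^T == 1%:M.
Proof. by rewrite trmx1 mulmx1. Qed.
Definition orth_one : orthogonal := exist _ 1%:M orth_one_subproof.

Fact orth_mul_subproof (A B : orthogonal) :
  (val A *m val B) *m (val A *m val B)^T == 1%:M.
Proof.
rewrite trmx_mul mulmxA -(mulmxA (val A)).
by rewrite (eqP (valP B)) mulmx1 (eqP (valP A)).
Qed.
Definition orth_mul (A B : orthogonal) : orthogonal :=
  exist _ (val A *m val B) (orth_mul_subproof A B).

Fact orth_inv_subproof (A : orthogonal) : (val A)^T *m (val A)^T^T == 1%:M.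
Proof. by rewrite trmxK; apply/eqP/mulmx1C/eqP; exact: (valP A). Qed.
Definition orth_inv (A : orthogonal) : orthogonal :=
  exist _ (val A)^T (orth_inv_subproof A).

Fact orth_mulA : associative orth_mul.
Proof. by move=> A B C; apply: val_inj; rewrite /= mulmxA. Qed.
Fact orth_mul1 : left_id orth_one orth_mul.
Proof. by move=> A; apply: val_inj; rewrite /= mul1mx. Qed.
Fact orth_mulr1 : right_id orth_one orth_mul.
Proof. by move=> A; apply: val_inj; rewrite /= mulmx1. Qed.
Fact orth_mulV : left_inverse orth_one orth_inv orth_mul.
Proof. by move=> A; apply/val_inj/mulmx1C/eqP; exact: (valP A). Qed.
Fact orth_mulrV : right_inverse orth_one orth_inv orth_mul.
Proof. by move=> A; apply/val_inj/eqP; exact: (valP A). Qed.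

HB.instance Definition _ := isGroup.Build orthogonal
  orth_mulA orth_mul1 orth_mulr1 orth_mulV orth_mulrV.

End Orthogonal.

Section Action.
Variables (R : realType) (T : R) (N : nat).

(* O(R/TZ) x Sigma(N) x O(R^3) with the library's direct product structure. *)
Definition G0 : Type := (circle_isom T * body_perm N * orthogonal R 3)%type.
HB.instance Definition _ := Group.on G0.

Definition loop : Type := circle T -> 'I_N -> 'cV[R]_3.

Definition loop_act (g : G0) (x : loop) : loop := fun t j =>
  val g.2 *m x ((g.1.1^-1)%g t) (((g.1.2 : 'S_N)^-1)%g j).

Definition stabilizer (x : loop) : set G0 := [set g | loop_act g x = x].

End Action.

Section Motion.
Variables (R : realType) (N k : nat).

Definition cis (a : R) : R[i] := cos a +i* sin a.

Definition zeta : R[i] := cis (2 * pi / N%:R).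

(* The sum is real: its imaginary parts cancel under j <-> N - j. *)
Definition omega : R := Num.sqrt (complex.Re
  (\sum_(1 <= j < N) (1 - zeta ^+ (j * k)) / `|zeta ^+ j - 1| ^+ 3)).

Definition period (s : nat) : R := 2 * pi * s%:R / omega.

(* R^3 = C x R, in the coordinates of 'cV[R]_3. *)
Definition vec3 (z : R[i]) (h : R) : 'cV[R]_3 :=
  \col_i [:: complex.Re z; complex.Im z; h]`_i.

(* Body j stands for the class of j in Z/NZ. *)
Definition motion (eta r : int) (s : nat) (t : R) (j : 'I_N) : 'cV[R]_3 :=
  vec3 (zeta ^+ j * cis (r%:~R / s%:R * omega * t))
       (complex.Re (zeta ^ (eta * (k * j)%:Z) * cis (omega * t))).

(* Independent of the chosen representative, motion being period-periodic. *)
Definition S_loop (eta r : int) (s : nat) : loop (period s) N :=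
  fun t => motion eta r s (repr t).

End Motion.

Arguments S_loop R N k eta r s : clear implicits.

(* 0 -> A -> B -> C -> 0, through i and p. *)
Definition short_exact (aT bT cT : finGroupType)
    (A : {group aT}) (B : {group bT}) (C : {group cT}) : Prop :=
  exists (i : {morphism A >-> bT}) (p : {morphism B >-> cT}),
    [/\ 'injm i, i @* A = 'ker p & p @* B = C]%g.

(* Main.v *)
Require Import Defs.
From mathcomp Require Import all_boot all_order all_algebra all_fingroup.
From mathcomp Require Import all_solvable.
From mathcomp Require Import generic_quotient ring_quotient complex.
From mathcomp Require Import all_classical all_reals all_analysis.
From mathcomp Require Import zify ring lra.
From HB Require Import structures.

Set Implicit Arguments.
Unset Strict Implicit.
Unset Printing Implicit Defensive.

Import Order.TTheory GRing.Theory Num.Theory.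

Local Open Scope ring_scope.

(** With X = e^(2 i pi t / T) the motion reads
      x_j(X) = (zeta^j X^r, Re (w_j X^s)),  w_j = zeta^(eta k j),
    for X on the unit circle, since omega = 2 pi s / T; so all of the analysis
    becomes algebra with unit complex numbers.

    Three symmetries are visible:
    - p: X -> p0 X and j -> j - eta, where p0 = e^(2 i pi k / (N s));
    - q: X -> q0 X with the bodies fixed, where q0 = e^(i pi / s), which
      reverses the heights;
    - c: complex conjugation of X and of the horizontal plane, with j -> - j.
    The stabilizer is {p^i q^j c^e}.  The elements p and q commute, and
    p^i = q^j holds exactly when i = N m and j = 2 k m mod 2 s for some m.
    This single relation gives the group structure: H = <p> <q>,
    C = <c>, K = <p> <q^2>.  Indeed p has order N s', and q^n is in <p> exactly
    when 2 gcd(k, s) divides n, so that H / <p> and K / <p> are cyclic of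
    orders 2 gcd(k, s) and gcd(k, s) (generalized_dihedral_structure).  The
    involution c is not in H because it reverses the cyclic order of the N >= 3
    bodies, so H has index 2.

    That there are no other symmetries is proved as follows.  Let (tau, sigma,
    rho) fix the motion.  An isometry of the circle is X -> u X or
    X -> u conj(X) (isom_chi).  The squared norm of x_j is 1 + height^2, so
    rho changes the height of each body at most by a sign; comparing scalar
    products of two bodies, whose horizontal part depends only on the time
    difference, shows that the sign e is common to all bodies
    (height_sign_const).  Hence rho^T e_3 - e e_3 is orthogonal to every
    position; the positions span the space unless the motion is flat
    (bodies_span), so rho preserves the vertical axis and acts on the
    horizontal plane as z -> a z or z -> a conj(z) (stabilizer_axis).  At time
    0 this forces sigma to be j -> j + b or j -> b - j; composing with c and a
    power of p makes sigma trivial.  Then time is not reversed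
    (time_reversal_moves_bodies; this is where the fixed polygon
    with alternating oscillations has to be excluded), so tau is a rotation by
    u with u^s = 1 or -1, that is, by a power of q0.  Finally an element of the
    stabilizer is determined by tau and sigma, again because the positions
    span the space. *)

(** * Finite groups inside infinite ones, and exact sequences *)

Lemma expg_modn (G : groupType) (x : G) m i :
  (x ^+ m = 1 -> x ^+ i = x ^+ (i %% m))%g.
Proof.
by move=> xm; rewrite {1}(divn_eq i m) expgnDr mulnC expgnA xm expg1n mul1g.
Qed.

(** The carrier is the list of values of f, so that the group law of G restricts
    to it and the embedding is just the projection to G. *)
Lemma finite_group_model (G : groupType) (F : finType) (f : F -> G)
    (S : set G) :
  (range f)%classic = S -> S 1%g ->
  (forall x y, S x -> S y -> S (x * y)%g) -> (forall x, S x -> S x^-1%g) ->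
  exists (gT : finGroupType) (phi : {multiplicative gT -> G}),
    injective phi /\ (range phi)%classic = S.
Proof.
move=> fS S1 SM SV.
have SP x : reflect (S x) (x \in codom f).
  apply: (iffP codomP) => [[y ->]|]; first by rewrite -fS; exists y.
  by rewrite -fS => -[y _ <-]; exists y.
pose T := seq_sub (codom f).
have vS (x : T) : S (val x) by apply/SP/valP.
pose m (x y : T) : T := SeqSub (introT (SP _) (SM _ _ (vS x) (vS y))).
pose o : T := SeqSub (introT (SP _) S1).
pose i (x : T) : T := SeqSub (introT (SP _) (SV _ (vS x))).
have mA : associative m by move=> x y z; apply: val_inj; rewrite /= mulgA.
have m1 : left_id o m by move=> x; apply: val_inj; rewrite /= mul1g.
have mV : left_inverse o i m by move=> x; apply: val_inj; rewrite /= mulVg.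
pose gT : finGroupType := HB.pack T (Finite_isGroup.Build T mA m1 mV).
have phiM : {morph (val : gT -> G) : x y / (x * y)%g} by [].
pose phi : {multiplicative gT -> G} :=
  HB.pack (val : gT -> G) (isMultiplicative.Build gT G _ phiM).
exists gT, phi; split; first exact: val_inj.
apply/seteqP; split => [_ [x _ <-]|x /SP Sx]; first exact: vS.
by exists (SeqSub Sx).
Qed.

(** The injection is an isomorphism onto the subgroup A', and the surjection is
    the quotient map by A' followed by an isomorphism. *)
Lemma short_exact_quotient (aT gT cT : finGroupType)
    (A : {group aT}) (A' B : {group gT}) (C : {group cT}) :
  (A \isog A' -> normal A' B -> B / A' \isog C -> short_exact A B C)%g.
Proof.
move=> /isogP[i injA iA] /andP[sAB nAB] /isogP[j injC jC].
have sB : (B \subset 'dom (j \o coset A'))%g.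
  by rewrite /= -sub_morphim_pre.
exists i, (restrm_morphism sB (comp_morphism (coset_morphism A') j)).
split=> //=; rewrite ?iA.
  rewrite ker_restrm ker_comp (trivgP injC) -kerE ker_coset.
  exact/esym/finset.setIidPr.
by rewrite morphim_restrm finset.setIid morphim_comp -jC.
Qed.

Lemma cyclic_Zp n : cyclic (Zp n).
Proof.
by rewrite /Zp; case: ifP; rewrite ?cyclic1 // Zp_cycle cycle_cyclic.
Qed.

Lemma short_exact_cyclic (gT : finGroupType) (A B : {group gT}) m n :
    (0 < m)%N -> (0 < n)%N -> normal A B -> cyclic A -> cyclic (B / A)%g ->
    #|A| = m -> #|(B / A)%g| = n ->
  short_exact (Zp m) B (Zp n).
Proof.
move=> m0 n0 nAB cA cBA oA oBA; apply: (short_exact_quotient _ nAB).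
  by rewrite isog_cyclic_card ?cyclic_Zp ?cA //= card_Zp ?oA.
by rewrite isog_sym isog_cyclic_card ?cyclic_Zp //= cBA card_Zp ?oBA /=.
Qed.

Lemma short_exact_index2 (gT : finGroupType) (K H : {group gT}) :
  normal K H -> #|H : K|%g = 2%N -> short_exact K H (Zp 2).
Proof.
move=> nKH iKH; apply: (short_exact_quotient (isog_refl K) nKH).
have oHK : #|(H / K)%g| = 2%N by rewrite card_quotient ?normal_norm.
by rewrite isog_sym isog_cyclic_card ?cyclic_Zp //= prime_cyclic oHK // card_Zp.
Qed.

(** * Groups generated by p, q and an involution *)

Section GeneralizedDihedral.
Variables (gT : finGroupType) (p q c : gT) (N k s s' : nat).
Hypotheses (N0 : (0 < N)%N) (k0 : (0 < k)%N) (s0 : (0 < s)%N).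
Hypothesis ss' : s = (gcdn k s * s')%N.
Hypothesis pqC : commute p q.
(* The only relations between p and q: those of the quotient of Z^2 in which
   p^N = q^(2k) and q^(2s) = 1. *)
Hypothesis pq_rel : forall a b, (p ^+ a = q ^+ b)%g <->
  exists2 m, a = (N * m)%N & b = (2 * k * m)%N %[mod 2 * s].

Let g0 : (0 < gcdn k s)%N. Proof. by rewrite gcdn_gt0 k0. Qed.

Lemma order_p : #[p]%g = (N * s')%N.
Proof.
apply/eqP; rewrite eqn_dvd; apply/andP; split.
  rewrite order_dvdn -(expg0 q); apply/eqP/pq_rel; exists s' => //.
  apply/esym/eqP; rewrite mod0n -/(dvdn _ _) -mulnA dvdn_pmul2l //.
  rewrite {1}ss' dvdn_pmul2r ?dvdn_gcdl //.
  by move: s0; rewrite ss' muln_gt0 => /andP[].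
have /eqP := expg_order p; rewrite -(expg0 q) => /eqP/pq_rel[m -> /esym].
rewrite mod0n => /eqP; rewrite -/(dvdn _ _) -mulnA dvdn_pmul2l // => skm.
rewrite dvdn_pmul2l // -(@Gauss_dvdr _ (k %/ gcdn k s)); last first.
  have -> : s' = (s %/ gcdn k s)%N by rewrite {1}ss' mulKn.
  rewrite /coprime -(eqn_pmul2r g0) mul1n muln_gcdl.
  rewrite !divnK ?dvdn_gcdl ?dvdn_gcdr //.
  by rewrite gcdnC.
by rewrite -(dvdn_pmul2l g0) -ss' mulnA (mulnC (gcdn k s)) divnK ?dvdn_gcdl.
Qed.

(** By the relation, q^n lies in <p> when n = 2 k m mod 2 s for some m; by
    Bezout these n are the multiples of 2 gcd(k, s). *)
Lemma expg_q_in_cycle_p n : (q ^+ n \in <[p]>)%g = (2 * gcdn k s %| n)%N.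
Proof.
apply/idP/idP => [/cycleP[a /esym/pq_rel[m _ nm]]|/dvdnP[x ->]].
  have dv : (2 * gcdn k s %| 2 * s)%N by rewrite dvdn_pmul2l ?dvdn_gcdr.
  rewrite /dvdn -(modn_dvdm n dv) nm (modn_dvdm _ dv) -/(dvdn _ _) -!mulnA.
  by rewrite dvdn_pmul2l // dvdn_mulr ?dvdn_gcdl.
have [u v uv _] := egcdnP s k0.
apply/cycleP; exists (N * (u * x))%N; apply/esym/pq_rel; exists (u * x)%N => //.
have -> : (2 * k * (u * x) = v * x * (2 * s) + x * (2 * gcdn k s))%N.
  by transitivity (2 * x * (u * k))%N; [|rewrite uv]; lia.
by rewrite modnMDl.
Qed.

Hypothesis c2 : (c ^+ 2 = 1)%g.
Hypothesis c_notin : forall a b, c != (p ^+ a * q ^+ b)%g.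
Hypothesis pqc_gen : forall x, exists a b (e : bool),
  x = (p ^+ a * q ^+ b * c ^+ e)%g.

Let H := (<[p]> <*> <[q]>)%G.
Let K := (<[p]> <*> <[q ^+ 2]>)%G.

Let cent_pq : (<[q]> \subset 'C(<[p]>))%g.
Proof. by rewrite cent_cycle cycle_subG; apply/cent1P. Qed.

Let HE : (H : {set gT}) = (<[p]> * <[q]>)%g.
Proof. by rewrite /= cent_joinEr. Qed.

Let abelH : abelian H.
Proof. by rewrite HE abelianM !cycle_abelian. Qed.

Let sKH : K \subset H.
Proof.
rewrite /= join_subG joing_subl.
by rewrite (fintype.subset_trans (cycleX q 2)) ?joing_subr.
Qed.

Let sub_normal (A B : {group gT}) : A \subset B -> B \subset H -> normal A B.
Proof.
by move=> sAB sBH; rewrite -sub_abelian_normal //; apply: abelianS sBH abelH.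
Qed.

Let nq : (q \in 'N(<[p]>))%g.
Proof.
by have := fintype.subset_trans cent_pq (cent_sub _); rewrite cycle_subG.
Qed.

Let quoH : (H / <[p]> = <[coset <[p]> q]>)%g.
Proof. by rewrite /= quotientYidl ?cycle_subG // quotient_cycle. Qed.

Let quoK : (K / <[p]> = <[coset <[p]> (q ^+ 2)]>)%g.
Proof.
by rewrite /= quotientYidl ?cycle_subG ?groupX // quotient_cycle ?groupX.
Qed.

(* Since #[p] is known, the orders of H and K = <p, q^2> follow from the
   orders of q and q^2 modulo <p>. *)
Let coset_q n : (coset <[p]> q ^+ n == 1)%g = (2 * gcdn k s %| n)%N.
Proof.
rewrite -morphX // -expg_q_in_cycle_p; apply/eqP/idP => [|/coset_id //].
by move/coset_idr; apply; rewrite groupX.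
Qed.

Let order_q : #[coset <[p]> q]%g = (2 * gcdn k s)%N.
Proof.
apply/eqP; rewrite eqn_dvd order_dvdn coset_q dvdnn -coset_q.
by rewrite expg_order eqxx.
Qed.

Let order_q2 : #[coset <[p]> (q ^+ 2)]%g = gcdn k s.
Proof.
rewrite morphX //.
apply/eqP; rewrite eqn_dvd order_dvdn -expgM coset_q dvdnn /=.
rewrite -(@dvdn_pmul2l 2) // -coset_q expgM.
by rewrite expg_order eqxx.
Qed.

Let card_quo (B : {group gT}) : (<[p]> \subset B)%g -> B \subset H ->
  #|B| = (#[p]%g * #|(B / <[p]>)%g|)%N.
Proof.
move=> spB sBH; rewrite card_quotient ?Lagrange //.
by apply: normal_norm; apply: sub_normal.
Qed.

Let cardH : #|H| = (2 * N * s)%N.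
Proof.
rewrite card_quo ?joing_subl // quoH -orderE order_q order_p {2}ss'. nia.
Qed.

Let cardK : #|K| = (N * s)%N.
Proof.
rewrite card_quo ?joing_subl // quoK -orderE order_q2 order_p {2}ss'. nia.
Qed.

Let c_notin_H : c \notin H.
Proof.
apply/negP; rewrite HE => /mulsgP[_ _ /cycleP[a ->] /cycleP[b ->] cE].
by have := c_notin a b; rewrite -cE eqxx.
Qed.

Let order_c : #[c]%g = 2%N.
Proof.
apply: nt_prime_order => //.
by apply: contra c_notin_H => /eqP ->; apply: group1.
Qed.

Let tiHc : (H :&: <[c]> = 1)%g.
Proof.
apply/eqP; rewrite finset.setIC prime_TIg -?orderE ?order_c // cycle_subG.
exact: c_notin_H.
Qed.

Let HcT : (H * <[c]> = [set: gT])%g.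
Proof.
apply/setP => x; rewrite finset.in_setT; have [a [b [e ->]]] := pqc_gen x.
by rewrite mem_mulg ?mem_cycle // HE mem_mulg ?mem_cycle.
Qed.

Lemma generalized_dihedral_structure :
  exists H C K : {group gT},
    [/\ (H ><| C = [set: gT])%g,
        (C \isog Zp 2)%g,
        abelian H,
        #|H| = (2 * N * s)%N &
        short_exact K H (Zp 2) /\
        short_exact (Zp (N * s')) K (Zp (gcdn k s))].
Proof.
exists H, <[c]>%G, K; split=> //.
- rewrite sdprodE //.
  have : normal H [set: gT].
    apply: index2_normal; first exact: finset.subsetT.
    rewrite -divgS ?finset.subsetT //= -HcT (TI_cardMg tiHc).
    by rewrite mulKn ?cardG_gt0.
  move=> nH; exact: (fintype.subset_trans (finset.subsetT _) (normal_norm nH)).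
- rewrite isog_cyclic_card ?cycle_cyclic //= cyclic_Zp card_Zp //.
  by rewrite -orderE order_c.
split.
  apply: short_exact_index2; first exact: sub_normal.
  by rewrite -divgS // cardH cardK -mulnA mulnK ?muln_gt0 ?N0.
apply: (@short_exact_cyclic _ <[p]>%G) => //.
- by rewrite -order_p order_gt0.
- exact: sub_normal (joing_subl _ _) sKH.
- exact: cycle_cyclic.
- by rewrite quoK cycle_cyclic.
- exact: order_p.
- by rewrite quoK -orderE order_q2.
Qed.

End GeneralizedDihedral.

(** * Unit complex numbers *)

Section UnitComplex.
Variable R : realType.
Implicit Types (a b : R) (z u v w y : R[i]).
Local Notation Re := complex.Re.
Local Notation Im := complex.Im.

(** Phrased with the conjugate, the equation itself says that the inverse of a
    unit complex number is its conjugate. *)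
Definition unimod z : bool := z * z^*%C == 1.

Lemma ReD u v : Re (u + v) = Re u + Re v. Proof. by case: u; case: v. Qed.
Lemma ReN u : Re (- u) = - Re u. Proof. by case: u. Qed.
Lemma ReM u v : Re (u * v) = Re u * Re v - Im u * Im v.
Proof. by case: u; case: v. Qed.
Lemma ImM u v : Im (u * v) = Re u * Im v + Im u * Re v.
Proof. by case: u; case: v. Qed.
Lemma ReJ u : Re u^*%C = Re u. Proof. by case: u. Qed.
Lemma ImJ u : Im u^*%C = - Im u. Proof. by case: u. Qed.
Lemma conjcM u v : (u * v)^*%C = u^*%C * v^*%C. Proof. exact: rmorphM. Qed.

Lemma complex_eq u v : Re u = Re v -> Im u = Im v -> u = v.
Proof. by case: u; case: v => /= ? ? ? ? -> ->. Qed.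

Lemma unimodP z : reflect (Re z ^+ 2 + Im z ^+ 2 = 1) (unimod z).
Proof.
case: z => a b; rewrite /unimod eq_complex /=.
apply: (iffP andP) => [[/eqP h _]|h]; first by rewrite -h; ring.
by split; apply/eqP; [rewrite -h|]; ring.
Qed.

Lemma unimod_neq0 z : unimod z -> z != 0.
Proof.
by apply: contraTneq => ->; rewrite /unimod mul0r eq_sym oner_eq0.
Qed.

Lemma unimodV z : unimod z -> z^-1 = z^*%C.
Proof.
move=> uz; apply: (mulfI (unimod_neq0 uz)).
by rewrite divff ?unimod_neq0 // (eqP uz).
Qed.

Lemma unimodJ z : unimod z -> unimod z^*%C.
Proof. by rewrite /unimod conjcK mulrC. Qed.

Lemma unimod1 : unimod 1.
Proof. by rewrite /unimod conjc1 mulr1. Qed.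

Lemma unimodM u v : unimod u -> unimod v -> unimod (u * v).
Proof.
by rewrite /unimod conjcM mulrACA => /eqP -> /eqP ->; rewrite mulr1.
Qed.

Lemma unimodX z n : unimod z -> unimod (z ^+ n).
Proof.
move=> uz; elim: n => [|n IH]; first by rewrite expr0 unimod1.
by rewrite exprS unimodM.
Qed.

Lemma unimodXz z (n : int) : unimod z -> unimod (z ^ n).
Proof.
move=> uz; case: n => n; first exact: unimodX.
by rewrite NegzE -exprnN unimodV ?unimodX // unimodJ ?unimodX.
Qed.

Lemma unimod_i : unimod 'i%C.
Proof. by apply/unimodP; rewrite /= expr0n expr1n add0r. Qed.

Lemma conjc_expz z (n : int) : unimod z -> (z ^ n)^*%C = z^*%C ^ n.
Proof.
by move=> uz; rewrite -!unimodV ?unimodXz // invr_expz exprz_inv.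
Qed.

Lemma Re_unimod_eq1 z : unimod z -> Re z = 1 -> z = 1.
Proof.
move=> /unimodP + h; rewrite h expr1n => /eqP.
rewrite -subr_eq0 addrAC subrr add0r sqrf_eq0 => /eqP h'.
exact: complex_eq.
Qed.

Lemma unimod_cis a : unimod (cis a).
Proof. by apply/unimodP; exact: cos2Dsin2. Qed.

Lemma cisD a b : cis (a + b) = cis a * cis b.
Proof.
apply: complex_eq; rewrite ?ReM ?ImM /= ?cosD ?sinD; ring.
Qed.

Lemma cis0 : cis 0 = 1 :> R[i].
Proof. by rewrite /cis cos0 sin0. Qed.

Lemma cisN a : cis (- a) = (cis a)^*%C.
Proof. by rewrite /cis cosN sinN. Qed.

Lemma cisX a n : cis a ^+ n = cis (n%:R * a).
Proof.
elim: n => [|n IH]; first by rewrite mul0r cis0.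
by rewrite exprS IH -cisD -natr1 mulrDl mul1r addrC.
Qed.

Lemma cisXz a (n : int) : cis a ^ n = cis (n%:~R * a).
Proof.
case: n => n; first exact: cisX.
rewrite NegzE -exprnN cisX unimodV ?unimod_cis // -cisN.
by rewrite mulNr.
Qed.

Lemma cis_surj z : unimod z -> exists a, z = cis a.
Proof.
move=> /unimodP uz; have Rz : -1 <= Re z <= 1.
  rewrite -ler_norml -ler_sqr ?nnegrE // expr1n real_normK ?num_real //.
  by rewrite -uz lerDl sqr_ge0.
have s2 : sin (acos (Re z)) ^+ 2 = Im z ^+ 2.
  by rewrite sin2cos2 acosK // -uz addrAC subrr add0r.
have /orP[/eqP h|/eqP h] :
    (sin (acos (Re z)) == Im z) || (sin (acos (Re z)) == - Im z).
  by rewrite -eqf_sqr s2.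
- by exists (acos (Re z)); apply: complex_eq; rewrite /= ?acosK.
- exists (- acos (Re z)); apply: complex_eq; rewrite /= ?cosN ?sinN ?acosK //.
  by rewrite h opprK.
Qed.

Lemma cis2pi : cis (2 * pi) = 1 :> R[i].
Proof. by rewrite /cis mulr_natl cos2pi sin2pi. Qed.

Lemma cis_eq1_small a : 0 <= a < 2 * pi -> cis a = 1 -> a = 0.
Proof.
move=> /andP[a0 a2] /(congr1 (@complex.Re R)) /= ca.
apply/eqP; rewrite eq_le a0 andbT leNgt; apply/negP => a_gt0.
have : 0 < sin (a / 2).
  by rewrite sin_gt0_pi // divr_gt0 //= ltr_pdivrMr // mulrC.
have := cos_mulr2n (a / 2).
rewrite -[a / 2 *+ 2]mulr_natr divfK // ca cos2sin2 => h s0.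
have : sin (a / 2) ^+ 2 = 0 by lra.
by move/eqP; rewrite sqrf_eq0 gt_eqF.
Qed.

Lemma cis_eq1 a : cis a = 1 -> exists n : int, a = n%:~R * (2 * pi).
Proof.
move=> a1; have p0 : 0 < 2 * pi :> R by rewrite mulr_gt0 ?pi_gt0.
pose n := Num.floor (a / (2 * pi)); exists n.
apply/eqP; rewrite -subr_eq0; apply/eqP/cis_eq1_small.
  have /andP[n1 n2] := floor_itv (a / (2 * pi)).
  rewrite subr_ge0 ltrBlDl -ler_pdivlMr // n1 /=.
  by rewrite -[X in _ + X]mul1r -mulrDl -ltr_pdivrMr // -intrD1.
by rewrite cisD a1 mul1r cisN -cisXz cis2pi exp1rz conjc1.
Qed.

(** If the angle 2 pi i / n lies strictly between 0 and 2 pi, then its cosine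
    is not 1 because the sine of the half angle is positive. *)
Lemma prim_cis n : (0 < n)%N -> n.-primitive_root (cis (2 * pi / n%:R) : R[i]).
Proof.
move=> n0; have n0R : 0 < n%:R :> R by rewrite ltr0n.
apply/andP; split=> //; apply/forallP => -[i /= lin]; apply/eqP.
rewrite unity_rootE cisX; apply/eqP/eqP => [h|->]; last first.
  by rewrite mulrC divfK ?gt_eqF // cis2pi.
apply/eqP; rewrite eqn_leq lin leqNgt /=; apply/negP => lt_in.
have p0 : 0 < 2 * pi :> R by rewrite mulr_gt0 ?pi_gt0.
have a0 : 0 < i.+1%:R * (2 * pi / n%:R) :> R.
  by rewrite mulr_gt0 ?divr_gt0 ?ltr0n.
have hb : 0 <= i.+1%:R * (2 * (pi : R) / n%:R) < 2 * (pi : R).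
  by rewrite (ltW a0) /= mulrCA gtr_pMr // ltr_pdivrMr // mul1r ltr_nat.
by rewrite (cis_eq1_small hb h) ltxx in a0.
Qed.

Lemma Im_as_Re u : Im u = Re (u * 'i%C^*%C).
Proof. by rewrite ReM /=; ring. Qed.

(** Two sinusoids with equal squares have the same zeros, hence opposite or
    equal phases: the test point is the zero i / v of the second one. *)
Lemma cosine_eq_pm u v : unimod u -> unimod v ->
  (forall y, unimod y -> Re (u * y) ^+ 2 = Re (v * y) ^+ 2) -> u = v \/ u = - v.
Proof.
move=> uu uv h.
have uu' := unimod_neq0 uu; have uv' := unimod_neq0 uv.
pose w := u * v^-1.
have uw : unimod w by rewrite unimodM // unimodV // unimodJ.
have uE : u = w * v by rewrite /w mulfVK.
have uvi : unimod (v^-1 * 'i%C).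
  by rewrite unimodM ?unimod_i // unimodV // unimodJ.
have /eqP := h _ uvi.
rewrite !mulrA -/w divff // mul1r /= expr0n sqrf_eq0 ReiNIm oppr_eq0 => /eqP Iw.
have := unimodP _ uw; rewrite Iw expr0n addr0 => /eqP.
rewrite sqrf_eq1 => /orP[]/eqP Rw; [left|right]; rewrite uE.
  by rewrite (_ : w = 1) ?mul1r //; apply: complex_eq.
by rewrite (_ : w = -1) ?mulN1r //; apply: complex_eq; rewrite /= ?oppr0.
Qed.

(** A sinusoid y -> Re (u y) determines u by its values at 1 and - i. *)
Lemma cosine_eq u v : (forall y, unimod y -> Re (u * y) = Re (v * y)) -> u = v.
Proof.
move=> h; apply: complex_eq; first by rewrite -[u]mulr1 h ?unimod1 ?mulr1.
by rewrite !Im_as_Re h ?unimodJ ?unimod_i.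
Qed.

End UnitComplex.

Section PowersOfUnitComplex.
Variable R : realType.
Local Notation Re := complex.Re.

Lemma conjcX (z : R[i]) m : (z ^+ m)^*%C = z^*%C ^+ m.
Proof. exact: rmorphXn. Qed.

(** Rotating both arguments by the same angle does not change a Hermitian
    product: this is why the horizontal part of a scalar product of positions
    depends only on the time difference. *)
Lemma unimod_cancel (a b c d e : R[i]) : unimod e ->
  a * (b * e) * (c * (d * e))^*%C = a * b * (c * d)^*%C.
Proof.
move=> /eqP ue; rewrite (conjcM c (d * e)) (conjcM d e) (conjcM c d).
move: ue; move: e^*%C d^*%C c^*%C => e' d' c' ue.
transitivity (a * b * (c' * d') * (e * e')); first by ring.
by rewrite ue mulr1.
Qed.

Lemma unimod_root (m : nat) (z : R[i]) : (0 < m)%N -> unimod z ->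
  exists2 y : R[i], unimod y & y ^+ m = z.
Proof.
move=> m0 /cis_surj[a ->]; exists (cis (a / m%:R)); first exact: unimod_cis.
by rewrite cisX mulrC divfK // pnatr_eq0 -lt0n.
Qed.

Lemma cis_rootX (a b : nat) : (0 < a)%N ->
  cis (2 * pi / (a * b)%:R) ^+ a = cis (2 * pi / b%:R) :> R[i].
Proof.
move=> a0; rewrite cisX natrM invfM mulrCA; congr cis.
by congr (_ * _); rewrite mulrA divff ?mul1r // pnatr_eq0 -lt0n.
Qed.

Lemma cosine_eqX (m : nat) (u v : R[i]) : (0 < m)%N ->
  (forall y, unimod y -> Re (u * y ^+ m) = Re (v * y ^+ m)) -> u = v.
Proof.
move=> m0 h; apply: cosine_eq => z /(unimod_root m0)[y uy <-]; exact: h.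
Qed.

Lemma cosine_eq_pmX (m : nat) (u v : R[i]) :
    (0 < m)%N -> unimod u -> unimod v ->
    (forall y, unimod y -> Re (u * y ^+ m) ^+ 2 = Re (v * y ^+ m) ^+ 2) ->
  u = v \/ u = - v.
Proof.
move=> m0 uu uv h; apply: cosine_eq_pm => // z /(unimod_root m0)[y uy <-].
exact: h.
Qed.

(** A root of unity of order |r| + 1 is a counterexample when r is nonzero. *)
Lemma unimod_expz_eq1 (r : int) :
  (forall z : R[i], unimod z -> z ^ r = 1) -> r = 0.
Proof.
move=> h; have uz := unimod_cis (2 * pi / `|r|.+1%:R : R).
have /eqP : (cis (2 * pi / `|r|.+1%:R : R)) ^+ `|r|%N = 1.
  have := h _ uz; case: (intP r) => [|m|m] //=.
  by rewrite -exprnN => /(congr1 GRing.inv); rewrite invrK invr1.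
rewrite -(prim_order_dvd (prim_cis R (ltn0Sn `|r|))).
have [->|r0 /dvdn_leq] := eqVneq r 0 => //.
by rewrite absz_gt0 r0 ltnn => /(_ isT).
Qed.

(** Two sinusoids with equal values have equal frequencies: evaluating at a
    primitive s-th root of unity gives s | r, so that s = 1 by coprimality, and
    then evaluating at a primitive r-th root of unity gives r | 1. *)
Lemma Re_expz_eq (r : int) (s : nat) : (0 < s)%N -> coprime `|r|%N s ->
  (forall z : R[i], unimod z -> Re (z ^ r) = Re (z ^+ s)) ->
  s = 1%N /\ (r = 1 \/ r = -1).
Proof.
move=> s0 rs h.
have expz_abs (z : R[i]) : unimod z -> z ^ r = 1 -> z ^+ `|r|%N = 1.
  move=> uz; case: (intP r) => [|m|m] //=.
  by rewrite -exprnN => /(congr1 GRing.inv); rewrite invrK invr1.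
have sr : (s %| `|r|)%N.
  rewrite (prim_order_dvd (prim_cis R s0)).
  apply/eqP/expz_abs; first exact: unimod_cis.
  apply: Re_unimod_eq1; first by rewrite unimodXz ?unimod_cis.
  by rewrite h ?unimod_cis // (prim_expr_order (prim_cis R s0)).
have s1 : s = 1%N.
  by apply/eqP; rewrite -dvdn1 -(eqP rs) dvdn_gcd sr dvdnn.
split=> //; rewrite s1 in h.
have r0 : (0 < `|r|)%N.
  rewrite absz_gt0; apply/eqP => r0; have := h _ (unimod_i R).
  by rewrite r0 expr0z expr1 /= => /eqP; rewrite oner_eq0.
have := prim_cis R r0; move: (unimod_cis (2 * pi / `|r|%N%:R : R)).
move: (cis _) => z uz pz.
have z1 : z = 1.
  apply: Re_unimod_eq1 => //; rewrite -[z]expr1 -h //.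
  have zr : z ^+ `|r|%N = 1 := prim_expr_order pz.
  have -> : z ^ r = 1; last by [].
  move: zr; case: (intP r) => [|m|m] //=.
  by rewrite -exprnN => ->; rewrite invr1.
have : (`|r| %| 1)%N by rewrite (prim_order_dvd pz) z1 expr1n.
by rewrite dvdn1; case: (intP r) => [|m|m] //= /eqP[]; [left|right]; lia.
Qed.

End PowersOfUnitComplex.

(** * The circle R/TZ and its isometries *)

Section CircleCharacter.
Variables (R : realType) (T : R).
Hypothesis T0 : 0 < T.
Local Open Scope quotient_scope.
Local Notation Re := complex.Re.

(** The isomorphism of R/TZ with the unit circle. *)
Definition chi (t : circle T) : R[i] := cis (2 * pi / T * repr t).

Let om_period (n : int) : cis (2 * pi / T * (n%:~R * T)) = 1 :> R[i].
Proof.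
by rewrite mulrCA divfK ?gt_eqF // -cisXz cis2pi exp1rz.
Qed.

Let pi_periods (a b : R) : \pi_(circle T) a = \pi_(circle T) b ->
  exists n : int, a - b = n%:~R * T.
Proof.
by move/eqP; rewrite -Quotient.idealrBE => /asboolP.
Qed.

Lemma chi_pi a : chi (\pi_(circle T) a) = cis (2 * pi / T * a).
Proof.
rewrite /chi; have [n] := pi_periods (reprK (\pi_(circle T) a)).
move/(canRL (subrK _)) ->.
by rewrite mulrDr cisD om_period mul1r.
Qed.

Lemma chiD s t : chi (s + t) = chi s * chi t.
Proof. by rewrite -[s]reprK -[t]reprK -raddfD !chi_pi mulrDr cisD. Qed.

Lemma chiN t : chi (- t) = (chi t)^*%C.
Proof. by rewrite -[t]reprK -raddfN !chi_pi mulrN cisN. Qed.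

Lemma chi0 : chi 0 = 1.
Proof. by rewrite -(raddf0 (\pi_(circle T))) chi_pi mulr0 cis0. Qed.

Lemma unimod_chi t : unimod (chi t). Proof. exact: unimod_cis. Qed.

Lemma chi_surj z : unimod z -> exists t, chi t = z.
Proof.
move=> /cis_surj[a ->]; exists (\pi_(circle T) (T / (2 * pi) * a)).
have p0 : 2 * pi != 0 :> R by rewrite gt_eqF // mulr_gt0 ?pi_gt0.
rewrite chi_pi mulrA -[T / _]invf_div divff ?mul1r //.
by rewrite mulf_neq0 // invr_eq0 gt_eqF.
Qed.

Lemma chi_inj : injective chi.
Proof.
suff chi1 t : chi t = 1 -> t = 0.
  move=> s t st; apply/eqP; rewrite -subr_eq0; apply/eqP/chi1.
  by rewrite chiD chiN st (eqP (unimod_chi t)).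
rewrite -[t]reprK chi_pi => /cis_eq1[n nE].
have -> : repr t = n%:~R * T.
  have p0 : 2 * pi != 0 :> R by rewrite gt_eqF // mulr_gt0 ?pi_gt0.
  apply: (mulfI p0); transitivity (T * (2 * pi / T * repr t)); last first.
    by rewrite nE; ring.
  by rewrite mulrA (mulrC T) divfK // gt_eqF.
rewrite -(raddf0 (\pi_(circle T))); apply/eqP; rewrite -Quotient.idealrBE subr0.
by apply/asboolP; exists n.
Qed.

(** Shifting the difference of representatives by the multiple of T that brings
    it into [-T/2, T/2] minimizes its absolute value. *)
Lemma circle_dist_attained (x y : circle T) : exists n : int,
  circle_dist x y = `|repr x - repr y + n%:~R * T|.
Proof.
pose d := repr x - repr y; pose n := Num.floor (d / T + 2^-1).
have /andP[n1 n2] := floor_itv (d / T + 2^-1).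
pose e := d + (- n)%:~R * T.
have eE : d = e + n%:~R * T by rewrite /e mulrNz mulNr subrK.
have T2 : `|e| <= T / 2.
  have -> : e = (d / T - n%:~R) * T.
    by rewrite mulrBl divfK ?gt_eqF // /e mulrNz mulNr.
  rewrite normrM (gtr0_norm T0) mulrC ler_pM2l // ler_norml.
  by move: n1 n2; rewrite intrD => *; apply/andP; split; lra.
exists (- n); rewrite -/d -/e; apply/eqP; rewrite eq_le; apply/andP; split.
  apply: ge_inf; first by exists 0 => _ [a [b [_ _ ->]]].
  exists (repr x + (- n)%:~R * T), (repr y); split; rewrite ?reprK //.
    rewrite -[RHS]reprK; apply/eqP.
    rewrite -Quotient.idealrBE addrAC subrr add0r.
    by apply/asboolP; exists (- n).
  by congr `|_|; rewrite /e /d addrAC.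
apply: lb_le_inf; first by exists `|d|, (repr x), (repr y); rewrite !reprK.
move=> _ [a [b [ax yb ->]]].
have [u uE] := pi_periods (etrans ax (esym (reprK x))).
have [v vE] := pi_periods (etrans yb (esym (reprK y))).
have -> : a - b = e + (n + u - v)%:~R * T.
  by rewrite intrB intrD !mulrBl mulrDl -uE -vE /e /d mulrNz; ring.
move: (n + u - v) => m; move: T2; rewrite ler_norml => /andP[eT1 eT2].
have [m0|m0|->] := ltrgtP m 0; last by rewrite mul0r addr0.
- have m1 : m%:~R <= -1 :> R by rewrite (_ : -1 = (-1)%:~R) ?ler_int //; lia.
  rewrite -[`|e + _|]normrN (le_trans _ (ler_norm _)) // ler_norml.
  by apply/andP; split; nra.
have m1 : 1 <= m%:~R :> R by rewrite (_ : 1 = 1%:~R) ?ler_int //; lia.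
rewrite (le_trans _ (ler_norm _)) // ler_norml.
by apply/andP; split; nra.
Qed.

(** Isometries are only used through this identity: they preserve the real part
    of the Hermitian product of the points of the unit circle. *)
Lemma cos_circle_dist x y :
  cos (2 * pi / T * circle_dist x y) = Re (chi x * (chi y)^*%C).
Proof.
have [n ->] := circle_dist_attained x y.
have om0 : 0 <= 2 * pi / T by rewrite divr_ge0 ?(ltW T0) // mulr_ge0 ?pi_ge0.
rewrite -{1}[2 * pi / T](ger0_norm om0) -normrM cos_norm.
have -> u : cos u = Re (cis u) by [].
by rewrite mulrDr cisD om_period mulr1 mulrBr cisD cisN.
Qed.

(** After division by the image of 0, an isometry preserves the real part (the
    product with 1) and, by comparison with the image of i, the imaginary part
    up to a sign that does not depend on the point. *)
Lemma isom_chi (f : circle_isom T) : exists c : R[i], unimod c /\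
  ((forall t, chi (f t) = c * chi t) \/
   (forall t, chi (f t) = c * (chi t)^*%C)).
Proof.
have pres x y : Re (chi (f x) * (chi (f y))^*%C) = Re (chi x * (chi y)^*%C).
  by rewrite -!cos_circle_dist isom_dist.
pose c := chi (f 0); have uc : unimod c by apply: unimod_chi.
pose G t := chi (f t) * c^-1; exists c; split=> //.
have fG t : chi (f t) = c * G t by rewrite mulrC mulfVK ?unimod_neq0.
have uG t : unimod (G t) by rewrite unimodM ?unimod_chi // unimodV // unimodJ.
have presG x y : Re (G x * (G y)^*%C) = Re (chi x * (chi y)^*%C).
  by rewrite -pres !fG (conjcM c) mulrACA (eqP uc) mul1r.
have G0 : G 0 = 1 by rewrite /G divff ?unimod_neq0.
have ReG t : Re (G t) = Re (chi t).
  by have := presG t 0; rewrite G0 chi0 conjc1 !mulr1.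
have [t1 t1i] := chi_surj (unimod_i R).
have ReG1 : Re (G t1) = 0 by rewrite ReG t1i.
have := unimodP _ (uG t1); rewrite ReG1 expr0n add0r => /eqP.
have ImG t : complex.Im (G t) * complex.Im (G t1) = complex.Im (chi t).
  have := presG t t1; rewrite t1i -Im_as_Re => <-.
  by rewrite ReM ReJ ImJ ReG1; ring.
rewrite sqrf_eq1 => /orP[]/eqP h; [left|right] => t; rewrite fG; congr (_ * _).
  by apply: complex_eq => //; rewrite -ImG h mulr1.
by apply: complex_eq; rewrite ?ReJ ?ImJ // -ImG h mulrN1 opprK.
Qed.

Let piD a b : \pi_(circle T) (a + b) = \pi_(circle T) a + \pi_(circle T) b.
Proof. exact: raddfD. Qed.

Let piN a : \pi_(circle T) (- a) = - \pi_(circle T) a.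
Proof. exact: raddfN. Qed.

Lemma circle_distD (c x y : circle T) :
  circle_dist (x + c) (y + c) = circle_dist x y.
Proof.
congr inf; apply/seteqP; split=> d [a [b [ax yb ->]]].
  exists (a - repr c), (b - repr c); rewrite !piD !piN ax yb reprK !addrK.
  by split=> //; congr `|_|; ring.
exists (a + repr c), (b + repr c); rewrite !piD ax yb reprK.
by split=> //; congr `|_|; ring.
Qed.

Lemma circle_distN (x y : circle T) : circle_dist (- x) (- y) = circle_dist x y.
Proof.
congr inf; apply/seteqP; split=> d [a [b [ax yb ->]]];
  exists (- a), (- b); rewrite !piN ax yb ?opprK.
  by split=> //; rewrite -normrN opprB addrC.
by split=> //; rewrite -normrN opprB addrC.
Qed.

Definition rotation (c : circle T) : circle_isom T :=
  CircleIsom (addrK c) (subrK c) (circle_distD c).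

Definition reflection : circle_isom T :=
  CircleIsom (@opprK _) (@opprK _) circle_distN.

End CircleCharacter.

(** * Orthogonal maps of C x R *)

Section Space.
Variable R : realType.
Local Notation Re := complex.Re.
Local Notation Im := complex.Im.

Let i0 : 'I_3 := ord0.
Let i1 : 'I_3 := @Ordinal 3 1 isT.
Let i2 : 'I_3 := @Ordinal 3 2 isT.

Let sum3 (F : 'I_3 -> R) : \sum_i F i = F i0 + F i1 + F i2.
Proof.
rewrite !big_ord_recl big_ord0 addr0 addrA.
by congr (_ + _ + _); congr F; apply: val_inj.
Qed.

Let ord3P (P : 'I_3 -> Prop) : P i0 -> P i1 -> P i2 -> forall i, P i.
Proof.
move=> P0 P1 P2 [[|[|[|//]]] lti].
- by rewrite (_ : Ordinal lti = i0) //; apply: val_inj.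
- by rewrite (_ : Ordinal lti = i1) //; apply: val_inj.
- by rewrite (_ : Ordinal lti = i2) //; apply: val_inj.
Qed.

Definition vdot (u v : 'cV[R]_3) : R := (u^T *m v) 0 0.

Lemma vdot_vec3 z z' h h' :
  vdot (vec3 z h) (vec3 z' h') = Re (z * z'^*%C) + h * h' :> R.
Proof. by rewrite /vdot mxE sum3 !mxE /= ReM ReJ ImJ; ring. Qed.

Lemma vdot_axis z h : vdot (vec3 0 1) (vec3 z h) = h.
Proof. by rewrite vdot_vec3 mul0r add0r mul1r. Qed.

Lemma vdot_orthogonal (A : Defs.orthogonal R 3) u v :
  vdot (val A *m u) (val A *m v) = vdot u v.
Proof.
rewrite /vdot trmx_mul mulmxA -(mulmxA u^T).
by rewrite (mulmx1C (eqP (valP A))) mulmx1.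
Qed.

Lemma vec3_inj (z z' : R[i]) h h' : vec3 z h = vec3 z' h' -> z = z' /\ h = h'.
Proof.
move=> /matrixP E; have := E i2 0; have := E i1 0; have := E i0 0.
by rewrite !mxE /= => ? ? ?; split=> //; apply: complex_eq.
Qed.

Lemma vdot_adjoint (A : 'M[R]_3) (e : R) u v :
  vdot u (A *m v) - e * vdot u v = vdot (A^T *m u - e *: u) v.
Proof.
have eu : (e *: u)^T = e *: u^T by apply/matrixP => i j; rewrite !mxE.
have split_tr : (A^T *m u - e *: u)^T = u^T *m A - e *: u^T.
  by rewrite raddfB /= trmx_mul trmxK eu.
rewrite /vdot split_tr mulmxBl -scalemxAl mulmxA.
by rewrite [in RHS]mxE; congr (_ + _); rewrite !mxE.
Qed.

Lemma vec3P (v : 'cV[R]_3) : exists z h, v = vec3 z h.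
Proof.
exists (v i0 0 +i* v i1 0)%C, (v i2 0); apply/matrixP => i j; rewrite ord1.
by elim/ord3P: i; rewrite !mxE.
Qed.

Definition frame (u v w : 'cV[R]_3) : 'M[R]_3 :=
  \matrix_(i, j) [:: u; v; w]`_j i 0.

Lemma frame_mul u v w z h :
  frame u v w *m vec3 z h = Re z *: u + Im z *: v + h *: w.
Proof.
by apply/matrixP => i j; rewrite ord1 !mxE sum3 !mxE /=; ring.
Qed.

Lemma frame_orthogonal u v w :
  vdot u u = 1 -> vdot v v = 1 -> vdot w w = 1 ->
  vdot u v = 0 -> vdot u w = 0 -> vdot v w = 0 ->
  frame u v w *m (frame u v w)^T == 1%:M.
Proof.
rewrite /vdot !mxE !sum3 !mxE => uu vv ww uv uw vw; apply/eqP/mulmx1C.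
apply/matrixP; elim/ord3P; elim/ord3P; rewrite !mxE !sum3 !mxE /=.
all: lra.
Qed.

(** The product map of z -> a z on C and h -> e h on R. *)
Definition screw_mx (a : R[i]) (e : R) : 'M[R]_3 :=
  frame (vec3 a 0) (vec3 (a * 'i%C) 0) (vec3 0 e).

Lemma screw_mxE a e z h : screw_mx a e *m vec3 z h = vec3 (a * z) (e * h).
Proof.
rewrite frame_mul; apply/matrixP => i j; rewrite ord1.
by elim/ord3P: i; rewrite !mxE /= ?ReM ?ImM /=; ring.
Qed.

Lemma screw_mx_orth a e : unimod a -> e ^+ 2 = 1 ->
  screw_mx a e *m (screw_mx a e)^T == 1%:M.
Proof.
move=> /unimodP ua e2; apply: frame_orthogonal;
  rewrite vdot_vec3 ReM ReJ ImJ ?ReM ?ImM /=; lra.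
Qed.

(** Complex conjugation on C and the identity on R. *)
Definition flip_mx : 'M[R]_3 := frame (vec3 1 0) (vec3 (- 'i%C) 0) (vec3 0 1).

Lemma flip_mxE z h : flip_mx *m vec3 z h = vec3 z^*%C h.
Proof.
rewrite frame_mul; apply/matrixP => i j; rewrite ord1.
by elim/ord3P: i; rewrite !mxE /= ?ReJ ?ImJ /=; ring.
Qed.

Lemma flip_mx_orth : flip_mx *m flip_mx^T == 1%:M.
Proof.
apply: frame_orthogonal; rewrite vdot_vec3 ReM ReJ ImJ /=; ring.
Qed.

(** The hypothesis says that the transpose of A sends the vertical vector to e
    times itself.  Then A preserves the axis and the horizontal plane, and the
    image of i is orthogonal to the image a of 1, hence is i a or - i a. *)
Lemma axis_orthogonal (A : Defs.orthogonal R 3) (e : R) : e ^+ 2 = 1 ->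
    (forall z h, vdot (vec3 0 1) (val A *m vec3 z h) = e * h) ->
  exists2 a : R[i], unimod a &
    (forall z h, val A *m vec3 z h = vec3 (a * z) (e * h)) \/
    (forall z h, val A *m vec3 z h = vec3 (a * z^*%C) (e * h)).
Proof.
move=> e2 hA; have e0 : e != 0 by rewrite -sqrf_eq0 e2 oner_eq0.
have A3 z h : exists z', val A *m vec3 z h = vec3 z' (e * h).
  have [z' [h' E]] := vec3P (val A *m vec3 z h); exists z'; rewrite E.
  by have := hA z h; rewrite E vdot_vec3 mul0r /= mul1r add0r => ->.
have [a aE] := A3 1 0; have [b bE] := A3 'i%C 0; have [c cE] := A3 0 1.
have := vdot_orthogonal A (vec3 1 0) (vec3 1 0).
have := vdot_orthogonal A (vec3 1 0) (vec3 'i%C 0).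
have := vdot_orthogonal A (vec3 'i%C 0) (vec3 'i%C 0).
have := vdot_orthogonal A (vec3 0 1) (vec3 0 1).
rewrite aE bE cE !vdot_vec3 !ReM !ReJ !ImJ /= => cc bb ab aa.
have {cc} c0 : c = 0.
  have /eqP : Re c ^+ 2 + Im c ^+ 2 = 0 by lra.
  rewrite paddr_eq0 ?sqr_ge0 // !sqrf_eq0 => /andP[/eqP ? /eqP ?].
  exact: complex_eq.
have ua : unimod a by apply/unimodP; lra.
have lin z h : val A *m vec3 z h =
    vec3 (Re z *: (a : Rcomplex R) + Im z *: (b : Rcomplex R)) (e * h).
  have -> : vec3 z h = Re z *: vec3 1 0 + Im z *: vec3 'i%C 0 + h *: vec3 0 1.
    by apply/matrixP; elim/ord3P => j; rewrite !mxE /=; ring.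
  rewrite !mulmxDr -!scalemxAr aE bE cE c0.
  apply/matrixP; elim/ord3P => j; rewrite !mxE /=.
  - by case: (a) (b) => ? ? [? ?] /=; ring.
  - by case: (a) (b) => ? ? [? ?] /=; ring.
  - by ring.
exists a => //; have := unimodP _ ua.
case: a {aE} ua lin aa ab => a1 a2 /= ua lin aa ab.
case: b {bE} lin ab bb => b1 b2 /= lin ab bb uA.
pose d := a1 * b2 - a2 * b1.
have ab0 : a1 * b1 + a2 * b2 = 0 by lra.
have bb1 : b1 ^+ 2 + b2 ^+ 2 = 1 by lra.
have b1E : b1 = - d * a2.
  transitivity (b1 * (a1 ^+ 2 + a2 ^+ 2) - a1 * (a1 * b1 + a2 * b2)).
    by rewrite ab0 uA; ring.
  by rewrite /d; ring.
have b2E : b2 = d * a1.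
  transitivity (b2 * (a1 ^+ 2 + a2 ^+ 2) - a2 * (a1 * b1 + a2 * b2)).
    by rewrite ab0 uA; ring.
  by rewrite /d; ring.
have /eqP : d ^+ 2 = 1.
  transitivity ((a1 ^+ 2 + a2 ^+ 2) * (b1 ^+ 2 + b2 ^+ 2)
                - (a1 * b1 + a2 * b2) ^+ 2).
    by rewrite /d; ring.
  by rewrite ab0 uA bb1; ring.
rewrite sqrf_eq1 => /orP[] /eqP dE; [left|right] => z h;
  rewrite lin; congr vec3;
  case: z => z1 z2; apply: complex_eq; rewrite /= ?b1E ?b2E dE; ring.
Qed.

End Space.

(** * The motion and its stabilizer *)

Section Motion.
Variables (R : realType) (n k : nat) (eta r : int) (s : nat).
Local Notation Re := complex.Re.
Local Notation N := n.+3.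
Local Notation zeta := (zeta R N).
Local Notation T := (period R N k s).
Hypotheses (hk1 : (1 <= k)%N) (hkN : (2 * k <= N)%N).
Hypothesis (heta : eta = -1 \/ eta = 1).
Hypotheses (hs : (1 <= s)%N) (hrs : coprime `|r|%N s).
Hypothesis hflat : ~ (k = 1%N /\ s = 1%N /\ r = eta).
Hypothesis hvert : ~ ((2 * k)%N = N /\ r = 0).

Lemma prim_zeta : N.-primitive_root zeta.
Proof. exact: prim_cis. Qed.

Lemma unimod_zeta : unimod zeta. Proof. exact: unimod_cis. Qed.

(** Every term of the sum has a nonnegative real part, and the term j = 1 has a
    positive one because 0 < k < N. *)
Lemma omega_gt0 : 0 < omega R N k.
Proof.
rewrite sqrtr_gt0 (big_morph (@complex.Re R) (@ReD R) (erefl _)).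
have term (j : nat) : exists2 c : R, (j = 1%N -> 0 < c) /\ 0 <= c &
    Re ((1 - zeta ^+ (j * k)) / `|zeta ^+ j - 1| ^+ 3)
    = (1 - Re (zeta ^+ (j * k))) * c.
  rewrite normc_def -rmorphXn -fmorphV; set c := (_ ^+ 3)^-1; exists c.
    split; last by rewrite invr_ge0 exprn_ge0 // sqrtr_ge0.
    move=> j1; rewrite invr_gt0 exprn_gt0 // sqrtr_gt0 j1.
    rewrite lt_neqAle addr_ge0 ?sqr_ge0 // andbT eq_sym.
    rewrite paddr_eq0 ?sqr_ge0 // !sqrf_eq0.
    apply/negP => /andP[/eqP a0 /eqP b0].
    have /eqP : zeta ^+ 1 - 1 = 0 by apply: complex_eq.
    by rewrite subr_eq0 -(prim_order_dvd prim_zeta).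
  by rewrite ReM ReD ReN /= mulr0 subr0.
have Re_le1 (z : R[i]) : unimod z -> Re z <= 1.
  by move=> /unimodP; nra.
have ge0 j : 0 <= Re ((1 - zeta ^+ (j * k)) / `|zeta ^+ j - 1| ^+ 3).
  have [c [_ c0] ->] := term j; rewrite mulr_ge0 // subr_ge0 Re_le1 //.
  by rewrite unimodX // unimod_zeta.
rewrite big_ltn //; apply: ltr_wpDr; first by apply: sumr_ge0.
have [c [c0 _] ->] := term 1%N; rewrite mulr_gt0 ?c0 // subr_gt0 lt_neqAle.
rewrite Re_le1 ?unimodX ?unimod_zeta // andbT; apply/eqP.
move/Re_unimod_eq1; rewrite unimodX ?unimod_zeta // => /(_ isT)/eqP.
rewrite -(prim_order_dvd prim_zeta) mul1n => /dvdn_leq; lia.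
Qed.

Lemma period_gt0 : 0 < T.
Proof.
by rewrite divr_gt0 ?omega_gt0 // !mulr_gt0 ?pi_gt0 ?ltr0n.
Qed.

Lemma zeta_ordD (i j : 'I_N) : zeta ^+ (i + j)%R = zeta ^+ i * zeta ^+ j.
Proof. by rewrite -exprD /= prim_expr_mod // prim_zeta. Qed.

Lemma zeta_ordN (j : 'I_N) : zeta ^+ (- j)%R = (zeta ^+ j)^*%C.
Proof.
have uz : unimod (zeta ^+ j) by rewrite unimodX ?unimod_zeta.
rewrite -unimodV //; apply: (mulfI (unimod_neq0 uz)).
by rewrite -zeta_ordD subrr divff ?unimod_neq0.
Qed.

Lemma zeta_ord_inj (i j : 'I_N) : zeta ^+ i = zeta ^+ j -> i = j.
Proof.
move/eqP; rewrite (eq_prim_root_expr prim_zeta) !modn_small // => /eqP.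
exact: val_inj.
Qed.

(** The phase of the vertical oscillation of body j. *)
Definition vphase (j : nat) : R[i] := zeta ^ (eta * (k * j)%:Z).

Lemma vphaseE j : vphase j = (zeta ^ (eta * k%:Z)) ^+ j.
Proof. by rewrite /vphase PoszM mulrA -exprz_exp. Qed.

Lemma vphaseD (i j : 'I_N) : vphase (i + j)%R = vphase i * vphase j.
Proof.
rewrite !vphaseE -exprD /= expr_mod // exprnP exprz_exp mulrC -exprz_exp.
by rewrite -exprnP (prim_expr_order prim_zeta) exp1rz.
Qed.

Lemma unimod_vphase j : unimod (vphase j).
Proof. by rewrite unimodXz // unimod_zeta. Qed.

(** The position of body j as a function of the point z = chi t of the unit
    circle. *)
Definition body_pos (z : R[i]) (j : 'I_N) : 'cV[R]_3 :=
  vec3 (zeta ^+ j * z ^ r) (Re (vphase j * z ^+ s)).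

Lemma S_loopE t j : S_loop R N k eta r s t j = body_pos (chi t) j.
Proof.
have w0 := omega_gt0; have s0 : s%:R != 0 :> R by rewrite pnatr_eq0 -lt0n.
rewrite /S_loop /motion /body_pos /chi cisXz cisX /period.
have p0 : 2 * pi != 0 :> R by rewrite gt_eqF // mulr_gt0 ?pi_gt0.
have -> : 2 * pi / (2 * pi * s%:R / omega R N k) = omega R N k / s%:R.
  by rewrite -[X in _ / X]mulrA invfM mulrA divff // mul1r invf_div.
congr vec3.
  by congr (_ * cis _); ring.
by congr (Re (_ * cis _)); field.
Qed.

Lemma stabilizerP (g : G0 T N) : stabilizer (S_loop R N k eta r s) g <->
  forall t j, val g.2 *m body_pos (chi t) j
    = body_pos (chi (g.1.1 t)) ((g.1.2 : 'S_N) j).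
Proof.
split=> [gS t j|gS].
  have gE t' j' :
      val g.2 *m S_loop R N k eta r s
        ((g.1.1^-1)%g t') (((g.1.2 : 'S_N)^-1)%g j')
      = S_loop R N k eta r s t' j'.
    exact: (congr1 (fun f : loop T N => f t' j') gS).
  have := gE (g.1.1 t) ((g.1.2 : 'S_N) j).
  have -> : (g.1.1^-1)%g (g.1.1 t) = t by exact: isom_funK.
  by rewrite permK S_loopE S_loopE.
apply/funext => t; apply/funext => j.
have := gS ((g.1.1^-1)%g t) (((g.1.2 : 'S_N)^-1)%g j).
have -> : g.1.1 ((g.1.1^-1)%g t) = t by exact: isom_invK.
by rewrite permKV -S_loopE -S_loopE.
Qed.

Lemma zeta_expz_eq1 (m : int) : zeta ^ m = 1 -> (N %| `|m|)%N.
Proof.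
rewrite (prim_order_dvd prim_zeta); case: (intP m) => [|i|i] //=.
  by move=> h; apply/eqP.
by rewrite -exprnN => /(congr1 GRing.inv); rewrite invrK invr1 => h; apply/eqP.
Qed.

(** A linear relation between the two sinusoids of frequencies r and s forces
    equal frequencies, that is s = 1 and r = 1 or - 1; the relation for two
    neighbouring bodies then forces equal phase shifts, k = eta r modulo N,
    which is the flat motion. *)
Lemma bodies_span (p : R[i]) (q : R) :
  (forall z j, unimod z -> vdot (vec3 p q) (body_pos z j) = 0) ->
  p = 0 /\ q = 0.
Proof.
move=> pq; pose f (z : R[i]) (j : 'I_N) := Re (p * (zeta ^+ j * z ^ r)^*%C).
have fE z j : unimod z -> f z j + q * Re (vphase j * z ^+ s) = 0.
  by move=> uz; rewrite -(pq z j uz) /body_pos vdot_vec3.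
have q0 : q = 0.
  apply/eqP; apply/negPn/negP => q0.
  have [s1 r1] : s = 1%N /\ (r = 1 \/ r = -1).
    apply: Re_expz_eq => // z uz.
    have e1 := fE z 0 uz; have e2 := fE z^*%C 0 (unimodJ uz).
    have e0 := fE 1 0 (unimod1 R).
    move: e1 e2 e0; rewrite /f /vphase muln0 mulr0 !expr0z !expr0 !mul1r.
    rewrite exp1rz expr1n conjc1 -conjc_expz // conjcK -rmorphXn ReJ.
    rewrite ![Re (p * _)]ReM ReJ ImJ /= => e1 e2 e0.
    have : q * (Re (z ^+ s) - Re (z ^ r)) = 0 by nra.
    by move/eqP; rewrite mulf_eq0 (negPf q0) subr_eq0 eq_sym => /eqP.
  have v1 : vphase 1 = zeta ^ r.
    have uzr : unimod (zeta ^ (- r)) by rewrite unimodXz ?unimod_zeta.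
    suff h : vphase 1 * zeta ^ (- r) = 1.
      by rewrite -[LHS](mulfK (unimod_neq0 uzr)) h mul1r invr_expz opprK.
    apply: cosine_eq => y uy.
    have := fE _ 1 (unimodM uzr uy); have := fE y 0 uy.
    rewrite /f s1 !expr1 expr0 !mul1r expfzMl.
    have -> : (zeta ^ (- r)) ^ r = zeta^-1.
      by rewrite exprz_exp; case: r1 => ->.
    rewrite [zeta * _]mulrA divff ?unimod_neq0 ?unimod_zeta // mul1r.
    rewrite [vphase 1 * (_ * _)]mulrA.
    have -> : vphase 0 = 1 by rewrite /vphase muln0 mulr0 expr0z.
    by rewrite mul1r => e0 e1; apply: (mulfI q0); lra.
  apply: hflat; suff : k%:Z = eta * r.
    move=> ker; split; [|split=> //]; move: ker;
      by case: heta => ->; case: r1 => ->; lia.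
  have : zeta ^ (eta * k%:Z - r) = 1.
    rewrite expfzDr ?unimod_neq0 ?unimod_zeta // -(muln1 k) -/(vphase 1) v1.
    by rewrite -expfzDr ?unimod_neq0 ?unimod_zeta // subrr.
  move/zeta_expz_eq1/dvdn_leq.
  by case: heta => ->; case: r1 => ->; lia.
split=> //.
have f0 (j : 'I_N) : Re (p * (zeta ^+ j)^*%C) = 0.
  by rewrite -(fE 1 j (unimod1 R)) q0 mul0r addr0 /f exp1rz mulr1.
have Rp : Re p = 0 by rewrite -[RHS](f0 0) expr0 conjc1 mulr1.
apply: complex_eq => //; have := f0 1.
rewrite expr1 ReM Rp mul0r add0r ImJ mulrN opprK.
move/eqP; rewrite mulf_eq0 => /orP[/eqP //|/eqP Iz].
have /eqP : zeta ^+ 2 = 1.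
  have /unimodP := unimod_zeta; rewrite Iz expr0n addr0 => Rz.
  apply: complex_eq; rewrite expr2 ?ReM ?ImM Iz ?mulr0 ?mul0r ?addr0 //.
  by rewrite subr0 -expr2.
by rewrite -(prim_order_dvd prim_zeta) => /dvdn_leq; lia.
Qed.

Lemma orthogonal_eq_on_bodies (A B : Defs.orthogonal R 3) :
  (forall z j, unimod z -> val A *m body_pos z j = val B *m body_pos z j) ->
  A = B.
Proof.
move=> AB; apply: val_inj; apply/eqP; rewrite -subr_eq0.
apply/eqP/row_matrixP => i.
rewrite row0 -[LHS]trmxK -[RHS]trmxK; congr (_^T).
have [p [q pqE]] := vec3P (row i (val A - val B))^T.
have [] := @bodies_span p q.
  move=> z j uz; rewrite /vdot -pqE trmxK -row_mul mulmxBl AB // subrr.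
  by rewrite row0 mxE.
rewrite pqE => -> ->; apply/matrixP => a b; rewrite !mxE.
by case: a => [[|[|[|]]]].
Qed.

Section Symmetry.
Variable g : G0 T N.
Hypothesis gS : stabilizer (S_loop R N k eta r s) g.
Let rho : Defs.orthogonal R 3 := g.2.
Let sigma : 'S_N := g.1.2.
Let tau : circle_isom T := g.1.1.
Let height (t : circle T) (j : 'I_N) : R := Re (vphase j * chi t ^+ s).
Let flat (t t' : circle T) (j l : 'I_N) : R :=
  Re ((zeta ^+ j * chi t ^ r) * (zeta ^+ l * chi t' ^ r)^*%C).

Let rho_pos t j :
  val rho *m body_pos (chi t) j = body_pos (chi (tau t)) (sigma j).
Proof. exact: (stabilizerP g).1. Qed.

Let inner t t' j l :
  flat (tau t) (tau t') (sigma j) (sigma l) +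
    height (tau t) (sigma j) * height (tau t') (sigma l) =
  flat t t' j l + height t j * height t' l.
Proof.
have := vdot_orthogonal rho (body_pos (chi t) j) (body_pos (chi t') l).
by rewrite !rho_pos !vdot_vec3.
Qed.

Let flat_diag t j : flat t t j j = 1.
Proof.
have u : unimod (zeta ^+ j * chi t ^ r).
  by rewrite unimodM ?unimodX ?unimodXz ?unimod_zeta ?unimod_chi.
by rewrite /flat (eqP u).
Qed.

Let flat_rotate t t' t1 t1' (u : R[i]) j l : unimod u ->
  chi t1 = chi t * u -> chi t1' = chi t' * u -> flat t1 t1' j l = flat t t' j l.
Proof.
move=> uu tE t'E; rewrite /flat tE t'E (expfzMl (chi t)) (expfzMl (chi t')).
by rewrite unimod_cancel // unimodXz.
Qed.

Let flat_shift t t' e j l : flat (t + e) (t' + e) j l = flat t t' j l.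
Proof.
by apply: (flat_rotate _ _ (unimod_chi e)); rewrite (chiD period_gt0).
Qed.

Let flat_isom_shift t t' e j l :
  flat (tau (t + e)) (tau (t' + e)) j l = flat (tau t) (tau t') j l.
Proof.
have [c [uc [tauE|tauE]]] := isom_chi period_gt0 tau.
  apply: (flat_rotate _ _ (unimod_chi e));
    by rewrite !tauE (chiD period_gt0) mulrA.
apply: (flat_rotate _ _ (unimodJ (unimod_chi e))).
  by rewrite !tauE (chiD period_gt0) (conjcM (chi t)) mulrA.
by rewrite !tauE (chiD period_gt0) (conjcM (chi t')) mulrA.
Qed.

(* The squared norm of a position is 1 plus the squared height. *)
Let height_sign j : exists2 e : R, e ^+ 2 = 1 &
  forall t, height (tau t) (sigma j) = e * height t j.
Proof.
have [u uu uE] : exists2 u, unimod u &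
    forall t, height (tau t) (sigma j) = Re (u * chi t ^+ s).
  have [c [uc [tauE|tauE]]] := isom_chi period_gt0 tau.
    exists (vphase (sigma j) * c ^+ s) => [|t].
      by rewrite unimodM ?unimodX ?unimod_vphase.
    by rewrite /height tauE exprMn mulrA.
  exists (vphase (sigma j) * c ^+ s)^*%C => [|t].
    by rewrite unimodJ // unimodM ?unimodX ?unimod_vphase.
  by rewrite /height tauE exprMn mulrA -[LHS]ReJ (conjcM (_ * _)) conjcX conjcK.
have sq y : unimod y -> Re (u * y ^+ s) ^+ 2 = Re (vphase j * y ^+ s) ^+ 2.
  move=> /(chi_surj period_gt0)[t <-]; have := inner t t j j.
  by rewrite !flat_diag -!expr2 uE => /addrI.
have [h|h] := cosine_eq_pmX hs uu (unimod_vphase j) sq.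
  by exists 1 => [|t]; rewrite ?expr1n // uE h mul1r.
by exists (-1) => [|t]; rewrite ?sqrrN ?expr1n // uE h mulNr ReN mulN1r.
Qed.

(* Choose times a and b at which the heights of bodies 0 and j are 1, and a
   shift d after which the height of body 0 is 0.  The horizontal products at
   (a, b) and (a + d, b + d) agree, before and after the symmetry, so the
   products of the heights change by the same amount: 1 - 0 = e0 e - 0. *)
Let height_sign_const : exists2 e : R, e ^+ 2 = 1 &
  forall t j, height (tau t) (sigma j) = e * height t j.
Proof.
have [e0 e02 h0] := height_sign 0; exists e0 => // t j.
have [e e2 h] := height_sign j; rewrite h; congr (_ * _).
have [y uy yE] := unimod_root hs (unimodJ (unimod_vphase 0)).
have [y' uy' yE'] := unimod_root hs (unimodJ (unimod_vphase j)).
have [z uz zE] := unimod_root hs (unimod_i R).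
have [a aE] := chi_surj period_gt0 uy; have [b bE] := chi_surj period_gt0 uy'.
have [d dE] := chi_surj period_gt0 uz.
have h0a : height a 0 = 1 by rewrite /height aE yE (eqP (unimod_vphase 0)).
have hjb : height b j = 1 by rewrite /height bE yE' (eqP (unimod_vphase j)).
have h0ad : height (a + d) 0 = 0.
  rewrite /height (chiD period_gt0) aE dE exprMn yE zE mulrA.
  by rewrite (eqP (unimod_vphase 0)) mul1r.
have := inner (a + d) (b + d) 0 j; have := inner a b 0 j.
rewrite flat_isom_shift flat_shift !h0 !h h0a hjb h0ad.
move: (flat _ _ _ _) (flat _ _ _ _) => f f' e1 e2'.
have ee : e0 * e = 1 by lra.
by rewrite -[LHS]mul1r -e02 expr2 -mulrA ee mulr1.
Qed.

(** The vector rho^T e_3 - e e_3 is orthogonal to all positions, hence zero. *)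
Lemma stabilizer_axis : exists2 e : R, e ^+ 2 = 1 & exists2 a : R[i], unimod a &
    (forall z h, val rho *m vec3 z h = vec3 (a * z) (e * h)) \/
    (forall z h, val rho *m vec3 z h = vec3 (a * z^*%C) (e * h)).
Proof.
have [e e2 he] := height_sign_const; exists e => //.
apply: axis_orthogonal => // z h.
have [p [q pqE]] := vec3P ((val rho)^T *m vec3 0 1 - e *: vec3 0 1).
have dotE u :
    vdot (vec3 0 1) (val rho *m u) - e * vdot (vec3 0 1) u = vdot (vec3 p q) u.
  by rewrite -pqE vdot_adjoint.
have [p0 q0] : p = 0 /\ q = 0.
  apply: bodies_span => y j /(chi_surj period_gt0)[t <-].
  rewrite -dotE rho_pos /body_pos (vdot_axis (_ * _)) (vdot_axis (_ * _)).
  by apply/eqP; rewrite subr_eq0; apply/eqP; apply: he.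
have /eqP := dotE (vec3 z h); rewrite p0 q0 vdot_axis.
have -> : vdot (vec3 0 0) (vec3 z h) = 0 by rewrite vdot_vec3 !mul0r addr0.
by rewrite subr_eq0 => /eqP.
Qed.

End Symmetry.

Local Notation stab := (stabilizer (S_loop R N k eta r s)).

Lemma stabilizer1 : stab 1%g.
Proof. by apply/stabilizerP => t j; rewrite /= mul1mx perm1. Qed.

Lemma stabilizerM g h : stab g -> stab h -> stab (g * h)%g.
Proof.
move=> /stabilizerP gS /stabilizerP hS; apply/stabilizerP => t j.
rewrite [val _](_ : _ = val g.2 *m val h.2) // -mulmxA hS gS.
by congr (body_pos _ _); rewrite permM.
Qed.

Lemma stabilizerV g : stab g -> stab g^-1%g.
Proof.
move=> /stabilizerP gS; apply/stabilizerP => t j.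
have := gS ((g.1.1^-1)%g t) (((g.1.2 : 'S_N)^-1)%g j).
have -> : g.1.1 ((g.1.1^-1)%g t) = t by exact: isom_invK.
rewrite permKV => <-; rewrite [val _](_ : _ = (val g.2)^T) // mulmxA.
by rewrite (mulmx1C (eqP (valP g.2))) mul1mx.
Qed.

Lemma stabilizerX g a : stab g -> stab (g ^+ a)%g.
Proof.
move=> gS; elim: a => [|a IH]; first exact: stabilizer1.
by rewrite expgS; apply: stabilizerM.
Qed.

(** The orthogonal part is determined by the other two because the positions
    span the space. *)
Lemma stabilizer_eq g h : stab g -> stab h ->
  (forall t, chi (g.1.1 t) = chi (h.1.1 t)) ->
  (forall j, (g.1.2 : 'S_N) j = (h.1.2 : 'S_N) j) -> g = h.
Proof.
case: g => -[tau sigma] rho; case: h => -[tau' sigma'] rho'.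
move=> /stabilizerP /= gS /stabilizerP /= hS tauE sigmaE.
have -> : tau = tau'.
  by apply: circle_isom_eq => t; apply/(chi_inj period_gt0)/tauE.
have -> : sigma = sigma' by apply/permP.
congr (_, _, _); apply: orthogonal_eq_on_bodies => z j.
move=> /(chi_surj period_gt0)[t <-].
by rewrite gS hS tauE sigmaE.
Qed.

(** On the stabilizer these are the symmetries that preserve the direction of
    time; they commute with each other. *)
Definition is_rot (g : G0 T N) (c : R[i]) (b : 'I_N) : Prop :=
  (forall t, chi (g.1.1 t) = c * chi t) /\ (forall j, (g.1.2 : 'S_N) j = j + b).

Lemma is_rot1 : is_rot 1%g 1 0.
Proof. by split=> [t|j]; rewrite ?mul1r // perm1 addr0. Qed.

Lemma is_rotM g h c c' b b' : is_rot g c b -> is_rot h c' b' ->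
  is_rot (g * h)%g (c * c') (b + b').
Proof.
move=> [gc gb] [hc hb]; split=> [t|j]; first by rewrite -mulrA -hc -gc.
by rewrite (addrC b) addrA -hb -gb permM.
Qed.

Lemma is_rotX g c b a : is_rot g c b -> is_rot (g ^+ a)%g (c ^+ a) (b *+ a).
Proof.
move=> gr; elim: a => [|a IH]; first exact: is_rot1.
by rewrite expgS exprS mulrS; apply: is_rotM.
Qed.

Lemma is_rotV g c b : c != 0 -> is_rot g c b -> is_rot g^-1%g c^-1 (- b).
Proof.
move=> c0 [gc gb]; split=> [t|j].
  apply: (mulfI c0); rewrite -gc mulrA divff // mul1r; congr chi.
  exact: isom_invK.
by apply: (@perm_inj _ (g.1.2 : 'S_N)); rewrite permKV gb subrK.
Qed.

Lemma is_rot_eq g h c b :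
  stab g -> stab h -> is_rot g c b -> is_rot h c b -> g = h.
Proof.
move=> gS hS [gc gb] [hc hb].
by apply: stabilizer_eq => // [t|j]; rewrite ?gc ?hc ?gb ?hb.
Qed.

Lemma is_rot_uniq g c b c' b' :
  is_rot g c b -> is_rot g c' b' -> c = c' /\ b = b'.
Proof.
move=> [gc gb] [gc' gb']; split; last by rewrite -[b]add0r -gb gb' add0r.
by rewrite -[c]mulr1 -(chi0 period_gt0) -gc gc' (chi0 period_gt0) mulr1.
Qed.

Lemma rot_in_stabilizer (c a : R[i]) (b : 'I_N) (e : R) :
    unimod c -> unimod a -> e ^+ 2 = 1 ->
    zeta ^+ b * c ^ r = a -> vphase b * c ^+ s = e%:C%C ->
  exists2 g, stab g & is_rot g c b.
Proof.
move=> uc ua e2 ha he; have [t0 t0E] := chi_surj period_gt0 uc.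
pose g : G0 T N := (rotation t0, perm (@addIr _ b) : body_perm N,
  exist _ (screw_mx a e) (screw_mx_orth ua e2) : Defs.orthogonal R 3).
have gr : is_rot g c b.
  by split=> [t|j] /=; rewrite ?permE // (chiD period_gt0) t0E mulrC.
exists g => //; apply/stabilizerP => t j; rewrite gr.1 gr.2 /=.
rewrite /body_pos screw_mxE zeta_ordD vphaseD exprMn expfzMl -ha.
congr vec3; first by ring.
rewrite mulrA -(mulrA (vphase j)) he (mulrC (vphase j) e%:C%C) -mulrA.
by rewrite [RHS]ReM (_ : complex.Im e%:C%C = 0) // mul0r subr0.
Qed.

Lemma flip_in_stabilizer : exists2 g : G0 T N, stab g &
  (forall t, chi (g.1.1 t) = (chi t)^*%C) /\ (forall j, (g.1.2 : 'S_N) j = - j).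
Proof.
pose g : G0 T N := (reflection T, perm (@oppr_inj _) : body_perm N,
  exist _ (flip_mx R) (flip_mx_orth R) : Defs.orthogonal R 3).
have gt t : chi (g.1.1 t) = (chi t)^*%C by exact: chiN period_gt0 _.
have gj j : (g.1.2 : 'S_N) j = - j by rewrite permE.
exists g => //; apply/stabilizerP => t j.
rewrite gt gj [val _](_ : _ = flip_mx R) //.
have vnegE : vphase (- j)%R = (vphase j)^*%C.
  have uz := unimod_vphase j.
  rewrite -unimodV //; apply: (mulfI (unimod_neq0 uz)).
  by rewrite -vphaseD subrr divff ?unimod_neq0 // vphaseE expr0.
rewrite /body_pos flip_mxE zeta_ordN vnegE; congr vec3.
  by rewrite conjcM (conjc_expz _ (unimod_chi _)).
by rewrite -conjcX -conjcM ReJ.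
Qed.

Lemma zeta_ordMn (b : 'I_N) a : zeta ^+ (b *+ a)%R = (zeta ^+ b) ^+ a.
Proof.
elim: a => [|a IH]; first by rewrite mulr0n !expr0.
by rewrite mulrS zeta_ordD IH exprS.
Qed.

(* The shift of the bodies by - eta. *)
Let b0 : 'I_N := if eta == 1 then -1 else 1.

Let zeta_b0 : zeta ^+ b0 = zeta ^ (- eta).
Proof.
rewrite /b0; case: heta => ->.
  by rewrite (_ : (-1 == 1 :> int) = false) // opprK expr1z.
rewrite eqxx; apply: (mulfI (unimod_neq0 unimod_zeta)).
rewrite -[X in X * _ = _]expr1 -(zeta_ordD 1) subrr expr0.
by rewrite divff ?unimod_neq0 ?unimod_zeta.
Qed.

Let vphase_b0 : vphase b0 * zeta ^+ k = 1.
Proof.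
have -> : vphase b0 = (zeta ^+ b0) ^ (eta * k%:Z).
  by rewrite vphaseE !exprnP !exprz_exp mulrC.
have uz := unimod_neq0 unimod_zeta.
rewrite zeta_b0 exprz_exp exprnP -expfzDr //.
have -> : - eta * (eta * k%:Z) + k%:Z = 0 by case: heta => ->; lia.
by rewrite expr0z.
Qed.

Let mulrn_b0_eq0 a : (b0 *+ a == 0) = (N %| a)%N.
Proof.
have -> : (b0 *+ a == 0) = ((zeta ^+ b0) ^+ a == 1).
  rewrite -zeta_ordMn; apply/eqP/eqP => [->|h]; first by rewrite expr0.
  by apply: zeta_ord_inj; rewrite h expr0.
rewrite zeta_b0 (prim_order_dvd prim_zeta) !exprnP exprz_exp.
case: heta => ->; first by rewrite opprK mul1r.
by rewrite mulN1r -invr_expz invr_eq1.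
Qed.

Let mulrn_b0_surj b : exists a, b = b0 *+ a.
Proof.
exists (if eta == 1 then (- b)%R : nat else b).
apply: zeta_ord_inj; rewrite zeta_ordMn zeta_b0 !exprnP exprz_exp.
case: heta => -> /=; first by rewrite opprK mul1r.
have uz := unimod_neq0 unimod_zeta.
rewrite mulN1r -invr_expz -!exprnP; apply: (mulIf (expf_neq0 (- b)%R uz)).
by rewrite mulVf ?expf_neq0 // -zeta_ordD subrr expr0.
Qed.

(* The time shift for which the heights of the bodies, shifted by - eta, come
   back to their values: p0^s = zeta^k. *)
Let p0 : R[i] := cis (2 * pi / (N * s)%:R) ^+ k.
(* The time shift by half a vertical period: q0^s = - 1. *)
Let q0 : R[i] := cis (2 * pi / (2 * s)%:R).

Let unimod_p0 : unimod p0. Proof. by rewrite unimodX ?unimod_cis. Qed.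
Let unimod_q0 : unimod q0. Proof. exact: unimod_cis. Qed.

Let prim_q0 : (2 * s).-primitive_root q0.
Proof. by apply: prim_cis; rewrite muln_gt0. Qed.

Let p0s : p0 ^+ s = zeta ^+ k.
Proof. by rewrite exprAC mulnC cis_rootX. Qed.

Let p0N : p0 ^+ N = q0 ^+ (2 * k).
Proof. by rewrite exprAC cis_rootX // exprM cis_rootX. Qed.

Let q0s : q0 ^+ s = -1.
Proof.
have /eqP : (q0 ^+ s) ^+ 2 = 1.
  by rewrite -exprM mulnC (prim_expr_order prim_q0).
rewrite sqrf_eq1 => /orP[|/eqP //].
rewrite -(prim_order_dvd prim_q0) => /dvdn_leq; lia.
Qed.

Lemma zeta_sqr_neq1 : zeta * zeta <> 1.
Proof.
rewrite -expr2 => /eqP.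
by rewrite -(prim_order_dvd prim_zeta) => /dvdn_leq; lia.
Qed.

Lemma one_neq_opp1 : 1 <> -1 :> 'I_N.
Proof.
move=> h; apply: zeta_sqr_neq1.
rewrite -[zeta]expr1; change (zeta ^+ (1%R : 'I_N) * zeta ^+ (1%R : 'I_N) = 1).
by rewrite -(zeta_ordD 1 1) {1}h addNr expr0.
Qed.

(** If time is reversed while no body moves, the horizontal motion is both
    z -> a z^r and z -> a z^-r, so r = 0; and, by comparison with body 0,
    all vertical phases are real, so 2 k = 0 modulo N. *)
Lemma time_reversal_moves_bodies (c a : R[i]) (e : R) :
    e ^+ 2 = 1 -> unimod c ->
  ~ (forall (z : R[i]) (j : 'I_N), unimod z ->
       vec3 (a * (zeta ^+ j * z ^ r)) (e * Re (vphase j * z ^+ s))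
       = body_pos (c * z^*%C) j).
Proof.
move=> e2 uc h.
have hh (z : R[i]) (j : 'I_N) : unimod z ->
    a * (zeta ^+ j * z ^ r) = zeta ^+ j * (c * z^*%C) ^ r.
  by move=> uz; have /vec3_inj[] := h z j uz.
have hv (z : R[i]) (j : 'I_N) : unimod z ->
    e * Re (vphase j * z ^+ s) = Re (vphase j * (c * z^*%C) ^+ s).
  by move=> uz; have /vec3_inj[] := h z j uz.
have aE : a = c ^ r.
  by have := hh 1 0 (unimod1 R); rewrite expr0 exp1rz conjc1 !mulr1 !mul1r.
have r0 : r = 0.
  suff : 2 * r = 0 by lia.
  apply: (@unimod_expz_eq1 R) => z uz; have := hh z 0 uz.
  rewrite expr0 !mul1r aE expfzMl => /(mulfI (unimod_neq0 (unimodXz r uc))).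
  rewrite mulrC -exprz_exp -(conjc_expz _ uz) => zz.
  by rewrite -[_ ^ 2]/(_ * _) {2}zz (eqP (unimodXz r uz)).
have v2 (j : 'I_N) : e%:C%C * vphase j = (vphase j * c ^+ s)^*%C.
  apply: (cosine_eqX hs) => y uy; rewrite -mulrA.
  rewrite -[RHS]ReJ (conjcM _ (y ^+ s)) conjcK conjcX -mulrA -exprMn -hv //.
  by rewrite [LHS]ReM (_ : complex.Im e%:C%C = 0) // mul0r subr0.
have ce : (c ^+ s)^*%C = e%:C%C.
  by have := v2 0; rewrite vphaseE expr0 mulr1 mul1r.
have v1 : vphase 1 = (vphase 1)^*%C.
  have := v2 1; rewrite conjcM ce mulrC; apply: mulIf.
  apply/eqP => -[e0]; move: e2; rewrite e0 expr0n => /eqP.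
  by rewrite eq_sym oner_eq0.
have : zeta ^ (2 * (eta * k%:Z)) = 1.
  rewrite mulrC -exprz_exp -[_ ^ 2]/(_ * _).
  rewrite -[X in X * _]expr1 -[X in _ * X]expr1 -vphaseE.
  by rewrite {2}v1 (eqP (unimod_vphase 1)).
move/zeta_expz_eq1 => dv; apply: hvert; split=> //.
have : (N %| 2 * k)%N.
  by move: dv; case: heta => ->; rewrite ?mul1r ?mulN1r ?mulrN ?abszN.
by move/dvdn_leq; lia.
Qed.

(** The orthogonal part cannot be of the conjugating type because zeta is not
    real, and time is not reversed, so the symmetry is a time shift u with
    u^s = 1 or - 1. *)
Lemma stabilizer_fixing_bodies (q g : G0 T N) :
  stab q -> is_rot q q0 0 -> stab g ->
  (forall j, (g.1.2 : 'S_N) j = j) -> exists b, g = (q ^+ b)%g.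
Proof.
move=> qS qr gS gj; have gP := (stabilizerP g).1 gS.
have [e e2 [a ua A]] := stabilizer_axis gS.
have [c [uc gc]] := isom_chi period_gt0 g.1.1.
have {A} A z h : val g.2 *m vec3 z h = vec3 (a * z) (e * h).
  case: A => // A; case: zeta_sqr_neq1.
  have eqh (j : 'I_N) : a * (zeta ^+ j)^*%C = zeta ^+ j * chi (g.1.1 0) ^ r.
    have := gP 0 j; rewrite gj (chi0 period_gt0) /body_pos A exp1rz mulr1.
    by case/vec3_inj.
  have := eqh 1; have := eqh 0; rewrite expr0 conjc1 mulr1 mul1r => <-.
  rewrite mulrC => /(mulIf (unimod_neq0 ua)); rewrite expr1 => {1}<-.
  by rewrite mulrC (eqP unimod_zeta).
case: gc => gc; last first.
  case: (@time_reversal_moves_bodies c a e e2 uc) => z j.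
  move=> /(chi_surj period_gt0)[t <-].
  by rewrite -A -gc -[in RHS](gj j) -gP.
have ce : e%:C%C = c ^+ s.
  apply: (cosine_eqX hs) => y /(chi_surj period_gt0)[t <-].
  have := gP t 0; rewrite gj gc /body_pos A => /vec3_inj[_].
  rewrite vphaseE expr0 !mul1r exprMn => <-.
  by rewrite ReM (_ : complex.Im e%:C%C = 0) // mul0r subr0.
have : c ^+ (2 * s) = 1.
  by rewrite mulnC exprM -ce -rmorphXn e2.
move/(prim_rootP prim_q0) => [b cE].
exists b; apply: (@is_rot_eq _ _ c 0) => //; first exact: stabilizerX.
  by split=> // j; rewrite gj addr0.
by rewrite cE -(mul0rn _ b); apply: is_rotX.
Qed.

Lemma rotation_generated (p q g : G0 T N) (b : 'I_N) :
    stab p -> is_rot p p0 b0 -> stab q -> is_rot q q0 0 -> stab g ->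
    (forall j, (g.1.2 : 'S_N) j = j + b) ->
  exists i j, g = (p ^+ i * q ^+ j)%g.
Proof.
move=> pS pr qS qr gS gb; have [i bE] := mulrn_b0_surj b.
have piS : stab (p ^+ i)^-1%g by apply/stabilizerV/stabilizerX.
have pir : is_rot (p ^+ i)^-1%g (p0 ^+ i)^-1 (- b).
  by rewrite bE; apply: is_rotV (is_rotX _ pr); apply/unimod_neq0/unimodX.
have [|j' jE] := stabilizer_fixing_bodies qS qr (stabilizerM piS gS).
  by move=> j; rewrite permM pir.2 gb addrK.
by exists i, j'; rewrite -jE mulKVg.
Qed.

(** The horizontal positions at time 0 are the N-th roots of unity, so the type
    of the orthogonal part decides whether the bodies undergo j -> j + b or
    j -> b - j; the second case is reduced to the first one by c. *)
Lemma stabilizer_generated (p q c g : G0 T N) :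
    stab p -> is_rot p p0 b0 -> stab q -> is_rot q q0 0 ->
    stab c -> (forall j, (c.1.2 : 'S_N) j = - j) -> (c ^+ 2 = 1)%g -> stab g ->
  exists i j (e : bool), g = (p ^+ i * q ^+ j * c ^+ e)%g.
Proof.
move=> pS pr qS qr cS cj c2 gS; have gP := (stabilizerP g).1 gS.
have [e e2 [a ua A]] := stabilizer_axis gS.
pose d := chi (g.1.1 0) ^ r; pose sigma0 := (g.1.2 : 'S_N) 0.
have d0 : d != 0 by rewrite unimod_neq0 // unimodXz // unimod_chi.
case: A => A.
  have eqh (j : 'I_N) : a * zeta ^+ j = zeta ^+ (g.1.2 : 'S_N) j * d.
    have := gP 0 j; rewrite (chi0 period_gt0) /body_pos A exp1rz mulr1.
    by case/vec3_inj.
  have [|i [j ->]] := rotation_generated (b := sigma0) pS pr qS qr gS.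
    move=> j; apply: zeta_ord_inj; rewrite zeta_ordD; apply: (mulIf d0).
    by rewrite -eqh mulrAC [RHS]mulrAC -mulrA -eqh expr0 mulr1 mulrC.
  by exists i, j, false; rewrite expg0 mulg1.
have eqh (j : 'I_N) : a * zeta ^+ (- j)%R = zeta ^+ (g.1.2 : 'S_N) j * d.
  have := gP 0 j; rewrite (chi0 period_gt0) /body_pos A exp1rz mulr1 zeta_ordN.
  by case/vec3_inj.
have [|i [j gcE]] :=
  rotation_generated (b := sigma0) pS pr qS qr (stabilizerM gS cS).
  move=> j; rewrite permM cj; apply: zeta_ord_inj; rewrite zeta_ordD.
  apply: (mulIf d0).
  by rewrite -eqh opprK -mulrA -eqh oppr0 expr0 mulr1 mulrC.
by exists i, j, true; rewrite -gcE expg1 -mulgA -expg2 c2 mulg1.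
Qed.

Lemma power_relation (p q : G0 T N) i j :
    stab p -> is_rot p p0 b0 -> stab q -> is_rot q q0 0 ->
  (p ^+ i = q ^+ j)%g <->
  exists2 m, i = (N * m)%N & j = (2 * k * m)%N %[mod 2 * s].
Proof.
move=> pS pr qS qr; have pi := is_rotX i pr.
have := is_rotX j qr; rewrite mul0rn => qj.
split=> [pq|[m iE jE]].
  rewrite pq in pi; have [/eqP pq0 /esym/eqP] := is_rot_uniq pi qj.
  rewrite eq_sym mulrn_b0_eq0 => /dvdnP[m iE]; exists m; first by rewrite mulnC.
  move: pq0; rewrite iE mulnC exprM p0N -exprM eq_sym.
  by rewrite (eq_prim_root_expr prim_q0) => /eqP.
apply: (is_rot_eq (stabilizerX i pS) (stabilizerX j qS) pi).
have -> : b0 *+ i = 0 by apply/eqP; rewrite mulrn_b0_eq0 iE dvdn_mulr.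
suff -> : p0 ^+ i = q0 ^+ j by [].
apply/eqP; rewrite iE exprM p0N -exprM eq_sym (eq_prim_root_expr prim_q0).
exact/eqP.
Qed.

(** The case N = n + 3, where the bodies are the elements of the ring 'I_N. *)
Theorem motion_stabilizer (s' : nat) (hs' : s = (gcdn k s * s')%N) :
  exists (gT : finGroupType) (phi : {multiplicative gT -> G0 T N}),
    [/\ injective phi, (range phi)%classic = stab &
        exists H C K : {group gT},
          [/\ (H ><| C = [set: gT])%g,
              (C \isog Zp 2)%g,
              abelian H,
              #|H| = (2 * N * s)%N &
              short_exact K H (Zp 2) /\
              short_exact (Zp (N * s')) K (Zp (gcdn k s))]].
Proof.
have [p pS pr] : exists2 p, stab p & is_rot p p0 b0.
  apply: (@rot_in_stabilizer p0 _ b0 1 unimod_p0 _ _ (erefl _));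
    rewrite ?expr1n //.
    by rewrite unimodM ?unimodX ?unimodXz ?unimod_zeta.
  by rewrite p0s vphase_b0.
have [q qS qr] : exists2 q, stab q & is_rot q q0 0.
  apply: (@rot_in_stabilizer q0 _ 0 (-1) unimod_q0 _ _ (erefl _));
    rewrite ?sqrrN ?expr1n //.
    by rewrite unimodM ?unimodX ?unimodXz ?unimod_zeta.
  by rewrite vphaseE expr0 mul1r q0s rmorphN rmorph1.
have [c cS [ct cj]] := flip_in_stabilizer.
have c2 : (c ^+ 2 = 1)%g.
  apply: stabilizer_eq (stabilizerX 2 cS) stabilizer1 _ _ => [t|j].
    by rewrite -[LHS]/(chi (c.1.1 (c.1.1 t))) !ct conjcK.
  by rewrite expg2 permM !cj opprK perm1.
have pqC : commute p q.
  have pq := is_rotM pr qr; have := is_rotM qr pr; rewrite mulrC addrC => qp.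
  exact: (is_rot_eq (stabilizerM pS qS) (stabilizerM qS pS) pq qp).
have p_ord : (p ^+ (N * s) = 1)%g.
  rewrite -(expg0 q); apply/(power_relation _ _ pS pr qS qr); exists s => //.
  by rewrite mod0n mulnAC modnMr.
have q_ord : (q ^+ (2 * s) = 1)%g.
  apply/esym; rewrite -(expg0 p); apply/(power_relation _ _ pS pr qS qr).
  by exists 0%N; rewrite ?muln0 // modnn mod0n.
have [gT [phi [phi_inj phiS]]] :
    exists (gT : finGroupType) (phi : {multiplicative gT -> G0 T N}),
    injective phi /\ (range phi)%classic = stab.
  pose f (u : 'I_(N * s) * 'I_(2 * s) * bool) :=
    (p ^+ u.1.1 * q ^+ u.1.2 * c ^+ u.2)%g.
  apply: (@finite_group_model _ _ f).
  - apply/seteqP; split=> [_ [[[i j] e] _ <-]|g].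
      by apply: stabilizerM; [apply: stabilizerM|]; apply: stabilizerX.
    move=> /(stabilizer_generated pS pr qS qr cS cj c2)[i [j [e gE]]].
    have Ns0 : (0 < N * s)%N by rewrite muln_gt0 hs.
    have s20 : (0 < 2 * s)%N by rewrite muln_gt0 hs.
    exists (Ordinal (ltn_pmod i Ns0), Ordinal (ltn_pmod j s20), e) => //.
    by rewrite gE /f /= -(expg_modn i p_ord) -(expg_modn j q_ord).
  - exact: stabilizer1.
  - by move=> x y; apply: stabilizerM.
  - by move=> x; apply: stabilizerV.
exists gT, phi; split=> //.
have phi1 : phi 1%g = 1%g by apply: (mulgI (phi 1%g)); rewrite -gmulfM !mulg1.
have phiX x m : phi (x ^+ m)%g = (phi x ^+ m)%g.
  by elim: m => [//|m IH]; rewrite !expgS gmulfM IH.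
have lift g : stab g -> exists x, phi x = g.
  by rewrite -phiS => -[x _ <-]; exists x.
have [p' pE] := lift p pS; have [q' qE] := lift q qS; have [c' cE] := lift c cS.
apply: (@generalized_dihedral_structure gT p' q' c' N k s s') => //.
- by apply: phi_inj; rewrite !gmulfM pE qE.
- move=> i j; apply: iff_trans (power_relation i j pS pr qS qr).
  by rewrite -pE -qE -!phiX; split=> [->|/phi_inj].
- by apply: phi_inj; rewrite phiX cE c2 phi1.
- move=> i j; apply/eqP => /(congr1 phi).
  rewrite gmulfM !phiX pE qE cE => cpq.
  have [_ rb] := is_rotM (is_rotX i pr) (is_rotX j qr).
  case: one_neq_opp1; rewrite -cj cpq rb.
  by have := rb 0; rewrite -cpq cj oppr0 add0r => <-; rewrite addr0.
move=> x; have : stab (phi x) by rewrite -phiS; exists x.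
move=> /(stabilizer_generated pS pr qS qr cS cj c2)[i [j [e gE]]].
by exists i, j, e; apply: phi_inj; rewrite gE !gmulfM !phiX pE qE cE.
Qed.

End Motion.

(* hflat and hvert exclude the two degenerate families for which the stabilizer
   has order 8N instead of 4Ns (with s = 1): a motion in a fixed plane on a
   common ellipse, and alternating vertical oscillations of a fixed N-gon.   *)
Theorem lemma12 (R : realType) (N k : nat) (eta r : int) (s s' : nat)
    (hN : (3 <= N)%N) (hk1 : (1 <= k)%N) (hkN : (2 * k <= N)%N)
    (heta : eta = -1 \/ eta = 1)
    (hs : (1 <= s)%N) (hrs : coprime `|r|%N s)
    (hs' : s = (gcdn k s * s')%N)
    (hflat : ~ (k = 1%N /\ s = 1%N /\ r = eta))
    (hvert : ~ ((2 * k)%N = N /\ r = 0)) :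
  exists (gT : finGroupType)
         (phi : {multiplicative gT -> G0 (period R N k s) N}),
    [/\ injective phi,
        (range phi)%classic = stabilizer (S_loop R N k eta r s) &
        exists H C K : {group gT},
          [/\ (H ><| C = [set: gT])%g,
              (C \isog Zp 2)%g,
              abelian H,
              #|H| = (2 * N * s)%N &
              short_exact K H (Zp 2) /\
              short_exact (Zp (N * s')) K (Zp (gcdn k s))]].
Proof.
case: N hN hkN hvert => [|[|[|n]]] // _ hkN hvert.
exact: motion_stabilizer.
Qed.
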